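(* Let $d\ge 3$ and $1\le\beta<\frac{d}{d-2}$. Then the operator $G^{(\beta)}$, given by $$G^{(\beta)}(F)(x)=\int_{\mathbb{R}^d}F(y)\,[g(x,y)]^\beta\,dy,\qquad F\in C_{\mathcal{K}}(\mathbb{R}^d),$$ satisfies the Complete Maximum Principle on $C_{\mathcal{K}}(\mathbb{R}^d)$.
   Context: $g(x,y)=C(d)\|x-y\|^{2-d}$ for $x\ne y\in\mathbb{R}^d$, with $C(d)=\frac{\Gamma(d/2-1)}{2\pi^{d/2}}$. $C_{\mathcal{K}}(\mathbb{R}^d)$ is the set of continuous real functions on $\mathbb{R}^d$ with compact support. A positive linear bounded operator $V$ defined on $C_{\mathcal{K}}(\mathcal{O})$ satisfies the Complete Maximum Principle (CMP) on $C_{\mathcal{K}}(\mathcal{O})$ if for every $F\in C_{\mathcal{K}}(\mathcal{O})$: if $V(F)(x)\le 1$ whenever $F(x)\ge 0$, then $V(F)(x)\le 1$ for all $x\in\mathcal{O}$. Here $\mathcal{O}=\mathbb{R}^d$. *)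

(* Defs.v *)
From HB Require Import structures.
From mathcomp Require Import all_boot all_order all_algebra.
From mathcomp Require Import all_classical all_reals all_analysis.

Set Implicit Arguments.
Unset Strict Implicit.
Unset Printing Implicit Defensive.

Import Order.TTheory GRing.Theory Num.Theory.
Import numFieldNormedType.Exports.

Local Open Scope classical_set_scope.
Local Open Scope ring_scope.

(* R^n is 'rV[R]_n: the topology is the library's (the product topology), and
   the sigma-algebra is the product of the Borel sigma-algebras of the
   coordinates, i.e. the Borel sigma-algebra of R^n. *)

Definition measure_rV_display : Type -> measure_display.
Proof. exact. Qed.

Section measurable_rV.
Context (R : realType) (n : nat).

Definition rV_coord (i : 'I_n) (x : 'rV[R]_n) : measurableTypeR R := x ord0 i.

Let rV_set0 : g_sigma_preimage rV_coord set0.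
Proof. exact: sigma_algebra0. Qed.

Let rV_setC A : g_sigma_preimage rV_coord A -> g_sigma_preimage rV_coord (~` A).
Proof. exact: sigma_algebraC. Qed.

Let rV_bigcup (F : (set 'rV[R]_n)^nat) :
  (forall i, g_sigma_preimage rV_coord (F i)) ->
  g_sigma_preimage rV_coord (\bigcup_i (F i)).
Proof. exact: sigma_algebra_bigcup. Qed.

HB.instance Definition _ := @isMeasurable.Build
  (measure_rV_display R)
  'rV[R]_n (g_sigma_preimage rV_coord) rV_set0 rV_setC rV_bigcup.

End measurable_rV.

Section measurable_rV_theory.
Context (R : realType).

Lemma measurable_rV_coord n (i : 'I_n) :
  measurable_fun [set: 'rV[R]_n] (@rV_coord R n i).
Proof.
move=> _ Y mY; rewrite setTI; apply: sub_sigma_algebra => /=.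
rewrite -bigcup_seq/=; exists i => /=; first by rewrite mem_index_enum.
by exists Y => //; rewrite setTI.
Qed.

Lemma measurable_fun_rVP d (T : measurableType d) n (f : T -> 'rV[R]_n) :
  (forall i, measurable_fun [set: T] (@rV_coord R n i \o f)) ->
  measurable_fun [set: T] f.
Proof.
move=> mf _ A mA.
have : g_sigma_preimage (fun i => @rV_coord R n i \o f) (setT `&` f @^-1` A).
  by rewrite g_sigma_preimage_comp; exists A.
apply: smallest_sub; first exact: sigma_algebra_measurable.
by rewrite -bigcup_seq; apply: bigcup_sub => i _ B [C mC <-]; exact: mf.
Qed.

End measurable_rV_theory.

Section lebesgue_rVS.
Context (R : realType) (n : nat).
Variable mu : {sigma_finite_measure set 'rV[R]_n -> \bar R}.

Definition rV_cons (p : measurableTypeR R * 'rV[R]_n) : 'rV[R]_n.+1 :=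
  row_mx (p.1 : R)%:M p.2.

Definition rV_uncons (x : 'rV[R]_n.+1) : measurableTypeR R * 'rV[R]_n :=
  (x ord0 ord0, rsubmx (x : 'rV[R]_(1 + n))).

Lemma rV_consK : cancel rV_cons rV_uncons.
Proof.
move=> [a v]; rewrite /rV_uncons /rV_cons row_mxKr; congr pair => /=.
transitivity (row_mx (a : R)%:M v 0 (lshift n (ord0 : 'I_1))).
  by congr (row_mx _ _ _ _); exact: val_inj.
by rewrite row_mxEl mxE eqxx mulr1n.
Qed.

Lemma measurable_rV_cons : measurable_fun setT rV_cons.
Proof.
apply: measurable_fun_rVP => i.
rewrite (_ : _ \o _ = fun p => row_mx (p.1 : R)%:M p.2 0 (i : 'I_(1 + n))) //.
case: (split_ordP (i : 'I_(1 + n))) => j ->.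
- under eq_fun do rewrite row_mxEl.
  rewrite (ord1 j); under eq_fun do rewrite mxE eqxx mulr1n.
  exact: measurable_fst.
- under eq_fun do rewrite row_mxEr.
  exact: (measurableT_comp (measurable_rV_coord j) measurable_snd).
Qed.

Lemma measurable_rV_uncons : measurable_fun setT rV_uncons.
Proof.
apply/measurable_fun_pairP; split.
  exact: (@measurable_rV_coord R n.+1 ord0).
apply: measurable_fun_rVP => i.
rewrite (_ : _ \o _ = @rV_coord R n.+1 (rshift 1 i)).
  exact: measurable_rV_coord.
by apply/funext => x; rewrite /rV_coord /= mxE.
Qed.

Definition lebesgue_rVS : set 'rV[R]_n.+1 -> \bar R :=
  pushforward (lebesgue_measure \x mu)%E rV_cons.

HB.instance Definition _ := isMeasurableFun.Build _ _ _ _ rV_cons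
  measurable_rV_cons.

Let lebesgue_rVS0 : lebesgue_rVS set0 = 0%E.
Proof. exact: measure0. Qed.

Let lebesgue_rVS_ge0 A : (0 <= lebesgue_rVS A)%E.
Proof. exact: measure_ge0. Qed.

Let lebesgue_rVS_sigma_additive : semi_sigma_additive lebesgue_rVS.
Proof. exact: measure_semi_sigma_additive. Qed.

HB.instance Definition _ := isMeasure.Build _ _ _ lebesgue_rVS
  lebesgue_rVS0 lebesgue_rVS_ge0 lebesgue_rVS_sigma_additive.

Let lebesgue_rVS_sigma_finite : sigma_finite setT lebesgue_rVS.
Proof.
have /sigma_finiteP[F [TF ndF Foo]] := sigma_finiteT (@lebesgue_measure R).
have /sigma_finiteP[G [TG ndG Goo]] := sigma_finiteT mu.
exists (fun k => rV_uncons @^-1` (F k `*` G k)).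
  apply/esym; rewrite -subTset => x _.
  have : setT (rV_uncons x).1 by [].
  rewrite TF => -[k _ Fk]; have : setT (rV_uncons x).2 by [].
  rewrite TG => -[l _ Gl]; exists (maxn k l) => //; split.
  - by move: Fk; exact/subsetPset/ndF/leq_maxl.
  - by move: Gl; exact/subsetPset/ndG/leq_maxr.
move=> k; have [mF Fk] := Foo k; have [mG Gk] := Goo k.
have mFG : measurable (F k `*` G k) by exact: measurableX.
split; first by rewrite -[X in measurable X]setTI; exact: measurable_rV_uncons.
rewrite /lebesgue_rVS /pushforward -comp_preimage.
rewrite (_ : _ \o _ = id); last by apply/funext => p; exact: rV_consK.
by rewrite preimage_id product_measure1E// lte_mul_pinfty// ge0_fin_numE.
Qed.

HB.instance Definition _ := Measure_isSigmaFinite.Build _ _ _ lebesgue_rVS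
  lebesgue_rVS_sigma_finite.

End lebesgue_rVS.

Fixpoint lebesgue_rV (R : realType) (n : nat) :
    {sigma_finite_measure set 'rV[R]_n -> \bar R} :=
  if n is n'.+1 then lebesgue_rVS (lebesgue_rV R n') else dirac (0 : 'rV[R]_0).

Lemma lebesgue_rV_prod (R : realType) (n : nat) (A : 'I_n -> set R) :
  (forall i, measurable (A i)) ->
  lebesgue_rV R n [set x | forall i, A i (x ord0 i)] =
  (\prod_(i < n) lebesgue_measure (A i))%E.
Proof.
elim: n A => [|n IHn] A mA.
  by rewrite big_ord0 /= diracE mem_set// => -[].
rewrite big_ord_recl -IHn //= /lebesgue_rVS /pushforward.
pose B : set 'rV[R]_n := [set x | forall i, A (lift ord0 i) (x ord0 i)].
rewrite -/B.
have mB : measurable B.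
  rewrite (_ : B = \bigcap_(i in [set: 'I_n]) (@rV_coord R n i @^-1` A (lift ord0 i))).
    apply: fin_bigcap_measurable; first exact: finite_finset.
    move=> i _.
    by rewrite -[X in measurable X]setTI; apply: measurable_rV_coord => //; exact: mA.
  by apply/seteqP; split=> [x Bx i _|x Bx i]; [exact: (Bx i)|exact: (Bx i I)].
rewrite -product_measure1E//; last exact: mA.
have cons0 (p : measurableTypeR R * 'rV[R]_n) : rV_cons p ord0 ord0 = p.1.
  by rewrite -[RHS](congr1 fst (rV_consK p)).
have consS (p : measurableTypeR R * 'rV[R]_n) i :
    rV_cons p ord0 (lift ord0 i) = p.2 ord0 i.
  transitivity (row_mx (p.1 : R)%:M p.2 ord0 (rshift 1 i)).
    by congr (row_mx _ _ _ _); exact: val_inj.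
  by rewrite row_mxEr.
congr (product_measure1 _ _ _); apply/seteqP.
split=> [p /= Ap|p [/= A0 Bp] i /=].
- split; first by rewrite /= -cons0.
  by move=> i /=; rewrite -consS.
- case: (unliftP ord0 i) => [j ->|->]; last by rewrite cons0.
  by rewrite consS; exact: Bp.
Qed.

Section green_operator.
Context (R : realType).

Definition Gamma (z : R) : R :=
  \int[lebesgue_measure]_(t in `]0, +oo[) (t `^ (z - 1) * expR (- t)).

(* The norm of the library on 'rV[R]_d is the sup norm. *)
Definition euclidean_norm (d : nat) (x : 'rV[R]_d) : R :=
  Num.sqrt (\sum_(i < d) x ord0 i ^+ 2).

Definition green_const (d : nat) : R :=
  Gamma (d%:R / 2 - 1) / (2 * pi `^ (d%:R / 2)).

(* Only meaningful for x != y. For d != 2 its value at x = y is 0, because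
   0 `^ a = 0 when a != 0; this is a null set for the integral below. *)
Definition green (d : nat) (x y : 'rV[R]_d) : R :=
  green_const d * euclidean_norm (x - y) `^ (2 - d%:R).

Definition green_op (d : nat) (beta : R) (F : 'rV[R]_d -> R) (x : 'rV[R]_d) : R :=
  \int[lebesgue_rV R d]_(y in setT) (F y * green x y `^ beta).

End green_operator.

Section complete_maximum_principle.
Context (R : realType) (d : nat).
Implicit Types (V : ('rV[R]_d -> R) -> ('rV[R]_d -> R)) (F : 'rV[R]_d -> R).

Definition compactly_supported_continuous F :=
  continuous F /\ compact (closure [set x | F x != 0]).

Local Notation CK := compactly_supported_continuous.

Definition linear_on_CK V :=
  forall (a : R) F G, CK F -> CK G ->
    forall x, V (fun y => a * F y + G y) x = a * V F x + V G x.

Definition positive_on_CK V :=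
  forall F, CK F -> (forall x, 0 <= F x) -> forall x, 0 <= V F x.

(* Boundedness is with respect to the usual topology of the space of compactly
   supported continuous functions: on the functions supported in a given
   compact set K, V is bounded for the sup norms. *)
Definition bounded_on_CK V :=
  forall K : set 'rV[R]_d, compact K ->
    exists M : R, forall F (c : R), CK F -> [set x | F x != 0] `<=` K ->
      (forall x, `|F x| <= c) -> forall x, `|V F x| <= M * c.

Definition complete_maximum_principle V :=
  [/\ linear_on_CK V, positive_on_CK V, bounded_on_CK V &
    forall F, CK F ->
      (forall x, 0 <= F x -> V F x <= 1) -> forall x, V F x <= 1].

End complete_maximum_principle.

(* Main.v *)
Require Import Defs.
From HB Require Import structures.
From mathcomp Require Import all_boot all_order all_algebra.
From mathcomp Require Import all_classical all_reals all_analysis measurable_realfun.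
From mathcomp Require Import ring lra.
Set Implicit Arguments.
Unset Strict Implicit.
Unset Printing Implicit Defensive.
Import Order.TTheory GRing.Theory Num.Theory.
Import numFieldNormedType.Exports.
Local Open Scope classical_set_scope.
Local Open Scope ring_scope.

(** Put g = d / 2 - beta (d - 2) / 2; the assumptions on beta say that
    0 < g <= 1. Up to a constant factor, green ^ beta is the Riesz kernel
    |x - y| ^ (2 g - d), which is a mixture of Gaussians: the integral over
    t > 0 of t ^ (g - 1) p_t(x - y), with p_t the heat kernel
    ([riesz_potE], [green_powE]). With P_t the heat semigroup, the operator is
    thus, up to a factor, V F = int_0^oo t ^ (g - 1) P_t F dt.

    The premise of the maximum principle bounds V F by 1 wherever F >= 0, hence
    everywhere but in a bounded set. As V F is continuous ([cvg_riesz_pot]),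
    a value above 1 would force V F to have a global maximum at some x0 with
    F x0 < 0 ([green_op_maximum]), and [no_negative_maximum] excludes this.

    At such a point put A t = P_t F x0. Averaging V F <= V F x0 against
    p_s(x0 - .), the semigroup property gives for every s > 0

      int_s^oo (t - s) ^ (g - 1) A t dt <= int_0^oo t ^ (g - 1) A t dt.

    If g = 1, this says that the integral of A over ]0, s] is nonnegative,
    whereas A t tends to F x0 < 0 when t tends to 0 ([no_separation_eq1]).
    If g < 1, the operator V inverts a fractional power of the Laplacian, which
    by subordination is an integral of I - P_s against s ^ (- g - 1) ds.
    Accordingly the inequality is integrated against this density, cut off to
    s > r to make its mass finite. The convolution of the cut-off density with
    t ^ (g - 1) is elementary ([integral_levy_abel]), and what is left is

      0 <= int_0^oo phi_r t * A t dt

    where phi_r >= 0 has an integral over ]0, r[ of order 1, and is at most of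
    order r ^ (1 - g) t ^ (g - 1) on any [delta, +oo[. When r tends to 0 the
    negative values of A near 0 prevail, a contradiction
    ([no_separation_lt1]).

    The positive and the negative part of F are carried along separately, so
    that all integrals are integrals of nonnegative functions and every
    exchange of integrals is an instance of Tonelli's theorem. *)

(** * Affine changes of variable and integrals of powers *)

Section affine.
Context {R : realType}.
Local Notation mu := (@lebesgue_measure R).

(** A named map, to which the structure of measurable function is attached: the
    push-forward is a measure only along such a map. *)
Definition affine (c a : R) (x : measurableTypeR R) : measurableTypeR R :=
  c * x + a.

Lemma measurable_affine c a : measurable_fun setT (affine c a).
Proof. by apply: measurable_funD => //; exact: measurable_funM. Qed.

HB.instance Definition _ c a :=
  isMeasurableFun.Build _ _ _ _ (affine c a) (measurable_affine c a).

(** The measure A |-> c * mu (affine c a @^-1` A) gives an interval its length,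
    and Lebesgue measure is the only such measure. *)
Lemma ge0_integral_affine (f : R -> \bar R) (c a : R) : 0 < c ->
  measurable_fun setT f -> (forall x, 0 <= f x)%E ->
  (\int[mu]_x f x = c%:E * \int[mu]_x f (c * x + a)%R)%E.
Proof.
move=> c0 mf f0.
have := @ge0_integral_pushforward _ _ _ _ _ _ (measurable_affine c a) mu _ _
  measurableT mf.
rewrite preimage_setT /= => <-; last by move=> y _; exact: f0.
have c0' := ltW c0.
rewrite -[c%:E]/((NngNum c0')%:num%:E).
rewrite -(@ge0_integral_mscale _ _ _ (pushforward mu (affine c a)))//.
apply: eq_measure_integral => //= A mA _.
apply: (@lebesgue_measure_unique R (mscale (NngNum c0') (pushforward mu (affine c
  a)))) => // X /ocitvP[->|[[u v]/= uv ->]].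
  by rewrite !measure0.
rewrite /mscale/= /pushforward (_ : _ @^-1` _ = `]((u - a) / c), ((v - a) / c)]%classic).
  rewrite !lebesgue_measure_itv/= !lte_fin ltr_pM2r ?invr_gt0// ltrD2r uv -!EFinB
    -EFinM; congr (_%:E); field.
  by rewrite gt_eqF.
by apply/seteqP; split=> x /=; rewrite !in_itv /= ltr_pdivrMr// ler_pdivlMr// ltrBlDr
  lerBrDr /affine ![x * c]mulrC.
Qed.

(** The integrands below may be singular at an end of the interval, so that only
    limits of the antiderivative are available there. The formula holds on the
    closed intervals [a + e n, b - e n], which exhaust ]a, b[. *)
Lemma ge0_FTC_oo (f G : R -> R) a b (la lb : R) : a < b ->
  (forall x, a < x < b -> 0 <= f x) ->
  {in `]a, b[, continuous f} ->
  (forall x, a < x < b -> is_derive x 1 G (f x)) ->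
  G x @[x --> a^'+] --> la -> G x @[x --> b^'-] --> lb ->
  (\int[mu]_(x in `]a, b[) (f x)%:E = (lb - la)%:E)%E.
Proof.
move=> ab f0 cf dG Ga Gb.
pose e (n : nat) : R := (b - a) / n.+3%:R.
have e0 n : 0 < e n by rewrite divr_gt0// subr_gt0.
have e2 n : 2 * e n < b - a.
  rewrite /e mulrCA -[ltRHS]mulr1 ltr_pM2l ?subr_gt0//.
  by rewrite ltr_pdivrMr// mul1r ltr_nat.
have ecvg : e n @[n --> \oo] --> (0:R).
  rewrite -(mulr0 (b - a)); apply: cvgM; first exact: cvg_cst.
  rewrite (_ : (fun n : nat => _) = (fun n => @harmonic R (n + 2)%N)).
    by rewrite (cvg_shiftn 2); exact: cvg_harmonic.
  by apply/funext => n; rewrite /= addn2.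
pose F n := [set` `[a + e n, b - e n]].
have FI n x : F n x -> a < x < b.
  by rewrite /F /= in_itv/=; have := e0 n; lra.
have UF : \bigcup_n F n = [set` `]a, b[].
  apply/seteqP; split=> [x [n _ /FI]|x /=]; first by rewrite /= in_itv.
  rewrite in_itv /= => /andP[ax xb].
  have m0 : 0 < Num.min (x - a) (b - x) by rewrite lt_min !subr_gt0 ax.
  have : \forall n \near \oo, e n < Num.min (x - a) (b - x).
    by apply: (cvgr_lt _ ecvg).
  case=> N _ /(_ N (leqnn N)) /=; rewrite lt_min => /andP[H1 H2].
  exists N => //; rewrite /F/= in_itv /=; lra.
have cfn n : {within F n, continuous f}.
  apply: continuous_in_subspaceT => x; rewrite inE => /FI xab.
  by apply: cf; rewrite in_itv.
rewrite -UF.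
have H : (\int[mu]_(x in F n) (f x)%:E)%E @[n --> \oo] --> (\int[mu]_(x in \bigcup_i
  F i) (f x)%:E)%E.
  apply: ge0_nondecreasing_set_cvg_integral.
  - move=> n m nm; apply/subsetPset => x; rewrite /F/= !in_itv/=.
    have : e m <= e n.
      rewrite /e ler_pM2l ?subr_gt0// lef_pV2 ?posrE// ler_nat.
      by rewrite !ltnS.
    lra.
  - by move=> n; exact: measurable_itv.
  - move=> n; apply/measurable_EFinP.
    by apply: subspace_continuous_measurable_fun => //; exact: measurable_itv.
  - by move=> n x /FI /f0; rewrite lee_fin.
have H2 : (\int[mu]_(x in F n) (f x)%:E)%E @[n --> \oo] --> (lb - la)%:E.
  have E n : (\int[mu]_(x in F n) (f x)%:E)%E = (G (b - e n) - G (a + e n))%:E.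
    have dGx x : a < x < b -> {for x, continuous G}.
      move=> xab; apply: differentiable_continuous; apply/derivable1_diffP.
      by have := dG _ xab => -[].
    rewrite /F (@continuous_FTC2 _ f G) ?EFinB//.
    - by have := e2 n; lra.
    - exact: cfn.
    - split.
      + move=> x; rewrite in_itv/= => xx.
        have xab : a < x < b by have := e0 n; lra.
        by have [] := dG _ xab.
      + apply: cvg_at_right_filter; apply: dGx.
        by have := e2 n; have := e0 n; lra.
      + apply: cvg_at_left_filter; apply: dGx.
        by have := e2 n; have := e0 n; lra.
    - move=> x; rewrite in_itv/= => xx.
      have xab : a < x < b by have := e0 n; lra.
      by rewrite derive1E; have [_ ->] := dG _ xab.
  under eq_fun do rewrite E.
  apply: cvg_EFin; first by near=> n.
  apply: cvgB.
  - move/cvg_at_leftP : Gb; apply; split => [n|].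
      by rewrite ltrBlDr ltrDl.
    by rewrite -[X in _ --> X]subr0; apply: cvgB => //; exact: cvg_cst.
  - move/cvg_at_rightP : Ga; apply; split => [n|].
      by rewrite ltrDl.
    by rewrite -[X in _ --> X]addr0; apply: cvgD => //; exact: cvg_cst.
exact: cvg_unique H H2.
Unshelve. all: by end_near. Qed.
End affine.

Section powers.
Context {R : realType}.
Local Notation mu := (@lebesgue_measure R).
Lemma is_derive_powR (x a : R) : 0 < x ->
  is_derive x 1 (@powR R ^~ a) (a * x `^ (a - 1)).
Proof.
move=> x0; have xin : x \in `]0, +oo[ by rewrite in_itv/= andbT.
apply: DeriveDef; first exact: (@derivable_powR R 1 a x xin).
by rewrite -derive1E powR_derive1.
Qed.

Lemma continuous_powR (x a : R) : 0 < x -> {for x, continuous (@powR R ^~ a)}.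
Proof.
move=> x0; apply: differentiable_continuous; apply/derivable1_diffP.
by apply: (@derivable_powR R 1 a x); rewrite in_itv/= andbT.
Qed.

Lemma cvg_powR_pinfty (p : R) : 0 < p -> x `^ p @[x --> +oo] --> +oo.
Proof.
move=> p0; apply/cvgryPge => A; near=> x.
have x1 : (`|A| + 1) `^ p^-1 <= x by near: x; exact: nbhs_pinfty_ge.
have A0 : 0 <= `|A| + 1 by rewrite addr_ge0.
rewrite (@le_trans _ _ (`|A| + 1))//; first by have := ler_norm A; lra.
rewrite -[leLHS]powRr1// -(@mulVf _ p) ?gt_eqF// powRrM.
by apply: ge0_ler_powR => //; rewrite ?nnegrE ?powR_ge0// ?ltW// (le_trans _ x1)//
  powR_ge0.
Unshelve. all: by end_near. Qed.

Lemma integral_powR_near0 (g b : R) : 0 < g -> 0 < b ->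
  (\int[mu]_(t in `]0%R, b[) (t `^ (g - 1))%R%:E = (b `^ g / g)%R%:E)%E.
Proof.
move=> g0 b0.
have g0' : g != 0 by rewrite gt_eqF.
transitivity (g^-1 * b `^ g - 0)%:E; last by rewrite subr0 mulrC.
apply: (@ge0_FTC_oo _ (fun t => t `^ (g - 1)) (fun x => g^-1 * x `^ g)); first exact: b0.
- by move=> x _; exact: powR_ge0.
- by move=> x; rewrite in_itv/= => /andP[x0 _]; exact: continuous_powR.
- move=> x /andP[x0 _]; have := is_derive_powR g x0 => H.
  by apply: is_derive_eq; rewrite /GRing.scale/= mulrA mulVf// mul1r.
- rewrite -[X in _ --> X](mulr0 g^-1); apply: cvgM; first exact: cvg_cst.
  exact: powR_cvg0.
- apply: cvgM; first exact: cvg_cst.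
  apply: cvg_at_left_filter; exact: continuous_powR.
Qed.

Lemma integral_powR_infty (p a : R) : 0 < p -> 0 < a ->
  (\int[mu]_(t in `[a, +oo[) (t `^ (- p - 1))%R%:E = (a `^ (- p) / p)%R%:E)%E.
Proof.
move=> p0 a0.
have p0' : p != 0 by rewrite gt_eqF.
rewrite (@ge0_continuous_FTC2y _ (fun t => t `^ (- p - 1)) (fun x => - p^-1 * x `^
  (-p)) a 0).
- by rewrite sub0e -EFinN; congr (_%:E); rewrite mulNr opprK mulrC.
- by move=> x _; exact: powR_ge0.
- apply: continuous_in_subspaceT => x; rewrite inE/= in_itv/= andbT => ax.
  by apply: continuous_powR; lra.
- rewrite -[X in _ --> X](mulr0 (- p^-1)); apply: cvgM; first exact: cvg_cst.
  under eq_fun do rewrite powRN.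
  apply/gtr0_cvgV0; last exact: cvg_powR_pinfty.
  near=> x; apply: powR_gt0; near: x; exact: nbhs_pinfty_gt.
- move=> x ax; have x0 : 0 < x by lra.
  by have := is_derive_powR (- p) x0 => H; apply: derivableM => //; have [] := H.
- apply: cvg_at_right_filter; apply: cvgM; first exact: cvg_cst.
  exact: continuous_powR.
- move=> x; rewrite in_itv/= andbT => ax; have x0 : 0 < x by lra.
  have := is_derive_powR (- p) x0 => H.
  rewrite derive1E; apply: derive_val.
  by apply: is_derive_eq; rewrite /GRing.scale/=; field.
Unshelve. all: by end_near. Qed.

(** The substitution v = t / s - 1 turns the integrand into v ^ (g - 1) / t,
    whence the antiderivative - (t / s - 1) ^ g / (g t). *)
Lemma integral_powR_beta (g r t : R) : 0 < g -> 0 < r -> r < t ->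
  (\int[mu]_(s in `]r, t[) (s `^ (- g - 1) * (t - s) `^ (g - 1))%R%:E =
   (g^-1 * t^-1 * (t / r - 1) `^ g)%R%:E)%E.
Proof.
move=> g0 r0 rt.
have t0 : 0 < t by lra.
have u0 x : r < x < t -> 0 < t / x - 1.
  by move=> rxt; rewrite subr_gt0 ltr_pdivlMr; lra.
have dV (x : R) : 0 < x -> is_derive x 1 (fun s : R => t / s - 1) (- t / x ^+ 2).
  move=> x0; have x0' : x != 0 by rewrite gt_eqF.
  have H := @is_deriveV R id x 1 1 x0' (is_derive_id x 1).
  have -> : (fun s : R => t / s - 1) = (fun s => t *: (s^-1 : R^o) - 1) by [].
  by apply: is_derive_eq; rewrite /GRing.scale/=; field.
have cV x : 0 < x -> {for x, continuous (fun s : R => t / s - 1)}.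
  move=> x0; apply: differentiable_continuous; apply/derivable1_diffP.
  by have [] := dV x x0.
transitivity (0 - (- (g^-1 * t^-1) * (t / r - 1) `^ g))%:E; last by congr (_%:E); ring.
apply: (@ge0_FTC_oo _ (fun s => s `^ (- g - 1) * (t - s) `^ (g - 1)) (fun s => -
  (g^-1 * t^-1) * (t / s - 1) `^ g)); first exact: rt.
- by move=> x _; rewrite mulr_ge0// powR_ge0.
- move=> x; rewrite in_itv/= => rxt; apply: cvgM; first by apply: continuous_powR; lra.
  apply: (@continuous_comp _ _ _ (fun x => t - x) (@powR R ^~ (g-1))).
    by apply: cvgB; [exact: cvg_cst|exact: cvg_id].
  by apply: continuous_powR; lra.
- move=> x rxt; have := is_derive_powR g (u0 _ rxt) => H.
  have x0 : 0 < x by lra.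
  have H2 := dV x x0.
  have := @is_derive1_comp _ (@powR R ^~ g) _ x _ _ H H2.
  move=> H3; apply: is_derive_eq; rewrite /GRing.scale/=.
  have -> : t - x = (t / x - 1) * x by field; rewrite gt_eqF.
  rewrite powRM; [|exact: ltW (u0 _ rxt)|lra].
  have -> : x `^ (- g - 1) = x `^ (- (g - 1)) * x `^ (- 2%:R).
    rewrite (_ : - g - 1 = - (g - 1) + - 2%:R); last by ring.
    by rewrite powRD// (gt_eqF x0) implybT.
  rewrite (powRN x (g - 1)) powR_invn; last lra.
  have : x `^ (g - 1) != 0 by rewrite gt_eqF// powR_gt0.
  move: (x `^ _) => y y0; field.
  by rewrite y0 !gt_eqF.
- apply: cvgM; first exact: cvg_cst.
  apply: cvg_at_right_filter.
  apply: (@cvg_comp _ _ _ (fun x => t / x - 1) (@powR R ^~ g) _ (nbhs (t / r - 1))).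
    exact: cV.
  apply: continuous_powR; rewrite subr_gt0 ltr_pdivlMr; lra.
- rewrite -[X in _ --> X](mulr0 (- (g^-1 * t^-1))); apply: cvgM; first exact: cvg_cst.
  have tt : t / t - 1 = 0 by rewrite divff ?gt_eqF// subrr.
  apply: (@decreasing_cvg_at_left_comp _ (fun x => t / x - 1) (@powR R ^~ g) (BRight r)).
  + by rewrite bnd_simp rt.
  + move=> x y; rewrite !in_itv/= => rx ry xy.
    by rewrite ltrD2r ltr_pM2l// ltf_pV2 ?posrE//; lra.
  + apply: cvg_at_left_filter.
    exact: cV.
  + rewrite tt; exact: powR_cvg0.
Qed.
End powers.

(** * Convolution with the Abel kernel *)

Section abel.
Context {R : realType}.
Local Notation mu := (@lebesgue_measure R).

(** The kernel of the fractional integral of order g, without its factor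
    1 / Gamma g, extended by 0 to make it a convolution kernel on the line. *)
Definition abel (g t : R) : R := if 0 < t then t `^ (g - 1) else 0.

Lemma abel_ge0 g t : 0 <= abel g t.
Proof. by rewrite /abel; case: ifP => // _; exact: powR_ge0. Qed.

Lemma measurable_abel g : measurable_fun setT (abel g).
Proof.
apply: measurable_fun_ifT.
- exact: measurable_fun_ltr.
- exact: measurable_powR.
- exact: measurable_cst.
Qed.

Lemma measurable_invr d (T : measurableType d) (f : T -> R) :
  measurable_fun setT f -> measurable_fun setT (fun x => (f x)^-1).
Proof.
move=> mf; have -> : (fun x => (f x)^-1) = (fun x => f x * (f x ^+ 2) `^ (- 1)).
  apply/funext => x; rewrite powR_inv1 ?sqr_ge0//.
  have [->|f0] := eqVneq (f x) 0; first by rewrite invr0 mul0r.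
  by field.
apply: measurable_funM => //; apply: (measurableT_comp (@measurable_powR R (- 1))).
exact: measurable_funX.
Qed.

Lemma measurable_EFin_mul d (T : measurableType d) (f : T -> R) (a : T -> \bar R) D :
  measurable_fun D f -> measurable_fun D a ->
  measurable_fun D (fun t => (f t)%:E * a t)%E.
Proof. by move=> mf ma; apply: (@emeasurable_funM _ _ _ _ (EFin \o f) a) => //;
  exact/measurable_EFinP. Qed.

(** The psi-terms cancel in the integral inequality, which leaves
    int phi b <= int phi a. The excess eta of b over a near 0 has to be made up
    for by the values of a beyond delta. *)
Lemma separation_weight_le (psi phi : R -> R) (a b : R -> \bar R) (delta eta : R) :
  0 < delta -> 0 < eta ->
  measurable_fun setT psi -> measurable_fun setT phi ->
  measurable_fun setT a -> measurable_fun setT b ->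
  (forall t, 0 <= psi t) -> (forall t, 0 <= phi t) ->
  (forall t, t <= 0 -> phi t = 0) ->
  (forall t, 0 <= a t)%E -> (forall t, 0 <= b t)%E ->
  (\int[mu]_t ((psi t)%:E * a t) < +oo)%E ->
  (\int[mu]_t ((psi t)%:E * b t) < +oo)%E ->
  (\int[mu]_t ((phi t)%:E * a t) < +oo)%E ->
  (\int[mu]_t ((psi t)%:E * a t) + \int[mu]_t ((psi t + phi t)%:E * b t) <=
   \int[mu]_t ((psi t + phi t)%:E * a t) + \int[mu]_t ((psi t)%:E * b t))%E ->
  (forall t : R, (0 < t < delta)%R -> (a t + eta%:E <= b t)%E) ->
  (eta%:E * \int[mu]_(t in `]0%R, delta[) (phi t)%:E <=
   \int[mu]_(t in `[delta, +oo[) ((phi t)%:E * a t))%E.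
Proof.
move=> d0 e0 mpsi mphi ma mb psi0 phi0 phiN a0 b0 fpa fpb ffa H near0.
have split2 c : measurable_fun setT c -> (forall t, 0 <= c t)%E ->
    (\int[mu]_t ((psi t + phi t)%:E * c t) =
     \int[mu]_t ((psi t)%:E * c t) + \int[mu]_t ((phi t)%:E * c t))%E.
  move=> mc c0; rewrite -ge0_integralD//.
  - by apply: eq_integral => t _; rewrite EFinD ge0_muleDl ?lee_fin.
  - by move=> t _; rewrite mule_ge0 ?lee_fin.
  - exact: measurable_EFin_mul.
  - by move=> t _; rewrite mule_ge0 ?lee_fin.
  - exact: measurable_EFin_mul.
have int0 (f : R -> R) c : (forall t, 0 <= f t) -> (forall t, 0 <= c t)%E ->
    (0 <= \int[mu]_t ((f t)%:E * c t))%E.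
  by move=> f0 c0; apply: integral_ge0 => t _; rewrite mule_ge0 ?lee_fin.
have {}H : (\int[mu]_t ((phi t)%:E * b t) <= \int[mu]_t ((phi t)%:E * a t))%E.
  move: H; rewrite !split2// -addeA leeD2lE; last by rewrite ge0_fin_numE// int0.
  by rewrite addeC leeD2rE // ge0_fin_numE// int0.
have UT : setT = `]-oo, 0%R] `|` (`]0%R, delta[ `|` `[delta, +oo[) :> set R.
  by apply/seteqP; split=> t //= _; rewrite !in_itv/=; case: (leP t 0) => t0;
    [left|right; case: (ltP t delta) => td; [left|right]].
have split3 c : measurable_fun setT c -> (forall t, 0 <= c t)%E ->
    (\int[mu]_t ((phi t)%:E * c t) =
     \int[mu]_(t in `]0%R, delta[) ((phi t)%:E * c t) +
     \int[mu]_(t in `[delta, +oo[) ((phi t)%:E * c t))%E.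
  move=> mc c0; rewrite [in LHS]UT ge0_integral_setU//=.
  - rewrite [X in (X + _)%E]integral0_eq ?add0e; last first.
      by move=> t; rewrite /= in_itv/= => t0; rewrite phiN// mul0e.
    rewrite ge0_integral_setU//=.
    + by apply: (@measurable_funS _ _ _ _ setT) => //; exact: measurable_EFin_mul.
    + by move=> t _; rewrite mule_ge0 ?lee_fin.
    + apply/disj_setPS => t [] /=; rewrite !in_itv/=; lra.
  - by apply: measurableU; exact: measurable_itv.
  - by apply: (@measurable_funS _ _ _ _ setT) => //; exact: measurable_EFin_mul.
  - by move=> t _; rewrite mule_ge0 ?lee_fin.
  - apply/disj_setPS => t [] /= + []; rewrite !in_itv/=; lra.
have mr (c : R -> \bar R) : measurable_fun setT c ->
  measurable_fun `]0%R, delta[ (fun t => (phi t)%:E * c t)%E.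
  by move=> mc; apply: (@measurable_funS _ _ _ _ setT) => //; exact: measurable_EFin_mul.
have int0' c : (forall t, 0 <= c t)%E -> (0 <= \int[mu]_(t in `]0%R, delta[) ((phi
  t)%:E * c t))%E.
  by move=> c0; apply: integral_ge0 => t _; rewrite mule_ge0 ?lee_fin.
have fa : (\int[mu]_(t in `]0%R, delta[) ((phi t)%:E * a t))%E \is a fin_num.
  rewrite ge0_fin_numE ?int0'//; apply: le_lt_trans ffa.
  rewrite split3// leeDl//; apply: integral_ge0 => t _.
  by rewrite mule_ge0 ?lee_fin.
rewrite -(@leeD2lE _ _ _ _ fa) -split3//; apply: le_trans H.
rewrite split3//; apply: (@le_trans _ _ (\int[mu]_(t in `]0%R, delta[) ((phi t)%:E *
  b t)))%E; last first.
  by rewrite leeDl//; apply: integral_ge0 => t _; rewrite mule_ge0 ?lee_fin.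
rewrite -ge0_integralZl//; last 3 first.
- by apply/measurable_EFinP; exact: (@measurable_funS _ _ _ _ setT).
- by move=> t _; rewrite lee_fin.
- by rewrite lee_fin ltW.
have mephi : measurable_fun `]0, delta[ (fun t => eta%:E * (phi t)%:E)%E.
  apply/measurable_EFinP; apply: measurable_funM => //.
  exact: (@measurable_funS _ _ _ _ setT).
rewrite -ge0_integralD//; last 3 first.
- by move=> t _; rewrite mule_ge0 ?lee_fin.
- exact: mr.
- by move=> t _; rewrite mule_ge0// lee_fin// ltW.
apply: ge0_le_integral => //.
- by move=> t _; rewrite adde_ge0 // mule_ge0// lee_fin// ltW.
- apply: emeasurable_funD; first exact: mr.
  exact: mephi.
- exact: mr.
- move=> t /=; rewrite in_itv/= => td; rewrite [(eta%:E * _)%E]muleC -ge0_muleDr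
    ?lee_fin ?(ltW e0)//.
  by apply: lee_wpmul2l; rewrite ?lee_fin// near0.
Qed.

End abel.

Section levy.
Context {R : realType}.
Local Notation mu := (@lebesgue_measure R).

(** The density of the jumps of the g-stable subordinator, restricted to jumps
    larger than r to make it integrable. *)
Definition levy (g r s : R) : R := if r < s then s `^ (- g - 1) else 0.

(** The convolution of [levy g r] with [abel g], by [integral_levy_abel]. *)
Definition levy_abel (g r t : R) : R :=
  if r < t then g^-1 * t^-1 * (t / r - 1) `^ g else 0.

Lemma levy_ge0 g r s : 0 <= levy g r s.
Proof. by rewrite /levy; case: ifP => // _; exact: powR_ge0. Qed.

Lemma measurable_levy g r : measurable_fun setT (levy g r).
Proof.
apply: measurable_fun_ifT.
- exact: measurable_fun_ltr.
- exact: measurable_powR.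
- exact: measurable_cst.
Qed.

Lemma integral_levy g r : 0 < g -> 0 < r ->
  (\int[mu]_s (levy g r s)%:E = (r `^ (- g) / g)%R%:E)%E.
Proof.
move=> g0 r0; rewrite -integral_powR_infty// -integral_itv_obnd_cbnd//.
  rewrite [RHS]integral_mkcond; apply: eq_integral => s _.
  by rewrite patchE /levy mem_setE in_itv/= andbT; case: ifP.
by apply/measurable_EFinP; apply: (@measurable_funS _ _ _ _ setT) => //;
  exact: measurable_powR.
Qed.

Lemma integral_levy_abel g r t : 0 < g -> 0 < r ->
  (\int[mu]_s (levy g r s * abel g (t - s)%R)%:E = (levy_abel g r t)%:E)%E.
Proof.
move=> g0 r0; rewrite /levy_abel; case: ltP => rt.
  rewrite -integral_powR_beta// [RHS]integral_mkcond; apply: eq_integral => s _.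
  rewrite patchE /levy /abel mem_setE in_itv/= subr_gt0.
  by case: (ltP r s) => rs/=; case: (ltP s t) => st//=; rewrite ?mulr0 ?mul0r.
apply: integral0_eq => s _; rewrite /levy /abel; case: ifPn; rewrite ?mul0r// => rs.
by rewrite ifN ?mulr0// -leNgt; lra.
Qed.

Lemma measurable_levy_abel g r : measurable_fun setT (levy_abel g r).
Proof.
apply: measurable_fun_ifT.
- exact: measurable_fun_ltr.
- apply: measurable_funM.
    by apply: measurable_funM => //; exact: measurable_invr.
  apply: (measurableT_comp (@measurable_powR R g)).
  by apply: measurable_funB => //; exact: measurable_funM.
- exact: measurable_cst.
Qed.

Lemma levy_abel_ge0 g r t : 0 < g -> 0 < r -> 0 <= levy_abel g r t.
Proof.
move=> g0 r0; rewrite /levy_abel; case: ifP => // rt.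
have t0 : 0 < t by lra.
by apply: mulr_ge0; [rewrite mulr_ge0// invr_ge0 ltW|exact: powR_ge0].
Qed.

Let abel_scaled (g r t : R) : 0 < r -> 0 < t ->
  r `^ (- g) / g * abel g t = g^-1 * t^-1 * (t / r) `^ g.
Proof.
move=> r0 t0; rewrite /abel t0.
have -> : t `^ (g - 1) = t `^ g / t.
  by rewrite -{3}(powRr1 (ltW t0)) -powRB// (gt_eqF t0) implybT.
rewrite powRM ?invr_ge0 ?ltW//.
rewrite -(powR_inv1 (ltW r0)) powRAC powR_inv1 ?powR_ge0// powRN.
by ring.
Qed.

(** The factor r ^ (- g) / g is the mass of [levy g r]. By [abel_scaled] the claim
    is (t / r - 1) ^ g <= (t / r) ^ g. *)
Lemma levy_abel_le g r t : 0 < g -> 0 < r -> levy_abel g r t <= r `^ (- g) / g * abel g t.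
Proof.
move=> g0 r0; rewrite /levy_abel; case: ifP => rt; last first.
  by rewrite mulr_ge0 ?abel_ge0// mulr_ge0 ?powR_ge0// invr_ge0 ltW.
have t0 : 0 < t by lra.
rewrite abel_scaled// ler_wpM2l ?mulr_ge0 ?invr_ge0 ?(ltW g0) ?(ltW t0)//.
apply: ge0_ler_powR; rewrite ?nnegrE; last by lra.
- exact: ltW.
- by rewrite subr_ge0 ler_pdivlMr// mul1r ltW.
- by rewrite divr_ge0 ?ltW.
Qed.

(** Since g <= 1, (1 - u) ^ g >= 1 - u for u = r / t: compared with a point mass
    at 0 of the same size, [levy g r] loses at most the proportion r / t. *)
Lemma levy_abel_ge g r t : 0 < g <= 1 -> 0 < r -> r < t ->
  r `^ (- g) / g * abel g t * (1 - r / t) <= levy_abel g r t.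
Proof.
move=> /andP[g0 g1] r0 rt; rewrite /levy_abel rt.
have t0 : 0 < t by lra.
rewrite abel_scaled// -[leLHS]mulrA ler_wpM2l ?mulr_ge0 ?invr_ge0 ?(ltW g0) ?(ltW t0)//.
have -> : t / r - 1 = t / r * (1 - r / t) by field; rewrite !gt_eqF.
have u0 : 0 < 1 - r / t by rewrite subr_gt0 ltr_pdivrMr// mul1r.
rewrite (@powRM _ (t / r)); first last.
- exact: ltW.
- by rewrite divr_ge0 ?ltW.
rewrite ler_pM2l; last by rewrite powR_gt0// divr_gt0.
have rt0 : 0 <= r / t by rewrite divr_ge0 ?ltW.
by apply: ger1_powR => //; lra.
Qed.

End levy.

Section no_separation.
Context {R : realType}.
Local Notation mu := (@lebesgue_measure R).

Lemma measurable_abel_shift g s : measurable_fun setT (fun t : R => abel g (t - s)).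
Proof.
apply: (measurableT_comp (measurable_abel g)).
exact: measurable_funB.
Qed.

Lemma measurable_levy_abel_shift g r (a : R -> \bar R) : measurable_fun setT a ->
  measurable_fun setT (fun p : R * R =>
    (levy g r p.1 * abel g (p.2 - p.1))%R%:E * a p.2)%E.
Proof.
move=> ma; apply: measurable_EFin_mul; last first.
  exact: (measurableT_comp ma measurable_snd).
apply: measurable_funM.
  exact: (measurableT_comp (measurable_levy g r) measurable_fst).
apply: (measurableT_comp (measurable_abel g)).
by apply: measurable_funB; [exact: measurable_snd|exact: measurable_fst].
Qed.

Lemma integral_levy_abel_shift g r (a : R -> \bar R) : 0 < g -> 0 < r ->
  measurable_fun setT a -> (forall t, 0 <= a t)%E ->
  (\int[mu]_s ((levy g r s)%:E * \int[mu]_t ((abel g (t - s)%R)%:E * a t)) =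
   \int[mu]_t ((levy_abel g r t)%:E * a t))%E.
Proof.
move=> g0 r0 ma a0.
have lk0 s t : (0 <= (levy g r s * abel g (t - s))%R%:E)%E.
  rewrite lee_fin; apply: mulr_ge0; [exact: levy_ge0|exact: abel_ge0].
transitivity (\int[mu]_s \int[mu]_t ((levy g r s * abel g (t - s)%R)%R%:E * a t))%E.
  apply: eq_integral => s _; rewrite -ge0_integralZl//.
  - by apply: eq_integral => t _; rewrite EFinM muleA.
  - by apply: measurable_EFin_mul => //; exact: measurable_abel_shift.
  - by move=> t _; rewrite mule_ge0// lee_fin abel_ge0.
  - by rewrite lee_fin levy_ge0.
rewrite (@fubini_tonelli _ _ _ _ _ mu mu (fun p : R * R =>
    (levy g r p.1 * abel g (p.2 - p.1))%R%:E * a p.2)%E)/=.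
- apply: eq_integral => t _; rewrite ge0_integralZr//.
  + by rewrite integral_levy_abel.
  + apply/measurable_EFinP; apply: measurable_funM; first exact: measurable_levy.
    apply: (measurableT_comp (measurable_abel g)).
    exact: measurable_funB.
- exact: measurable_levy_abel_shift.
- by move=> p; rewrite mule_ge0.
Qed.

Lemma measurable_abel_conv g (a : R -> \bar R) :
  measurable_fun setT a -> (forall t, 0 <= a t)%E ->
  measurable_fun setT
    (fun s : R => \int[mu]_t ((abel g (t - s)%R)%:E * a t))%E.
Proof.
move=> ma a0.
apply: (@measurable_fun_fubini_tonelli_F _ _ _ _ _ mu
  (fun p : R * R => (abel g (p.2 - p.1))%R%:E * a p.2)%E).
- apply: measurable_EFin_mul; last first.
    exact: (measurableT_comp ma measurable_snd).
  apply: (measurableT_comp (measurable_abel g)).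
  by apply: measurable_funB; [exact: measurable_snd|exact: measurable_fst].
- by move=> p; rewrite mule_ge0// lee_fin abel_ge0.
Qed.

(** In the application a t and b t are the values at a maximum of V F of P_t
    applied to the positive and the negative part of F. The last
    hypothesis is averaged over s with density [levy g r]; by the two bounds on [levy_abel],
    [separation_weight_le] then yields eta r ^ g / g <= (r / delta) int abel a,
    which is false for small r since g < 1. *)
Lemma no_separation_lt1 (g : R) (a b : R -> \bar R) (delta eta : R) :
  0 < g < 1 -> 0 < delta -> 0 < eta ->
  measurable_fun setT a -> measurable_fun setT b ->
  (forall t, 0 <= a t)%E -> (forall t, 0 <= b t)%E ->
  (\int[mu]_t ((abel g t)%:E * a t) < +oo)%E ->
  (\int[mu]_t ((abel g t)%:E * b t) < +oo)%E ->
  (forall t : R, (0 < t < delta)%R -> (a t + eta%:E <= b t)%E) ->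
  (forall s : R, (0 < s)%R ->
    \int[mu]_t ((abel g (t - s)%R)%:E * a t) + \int[mu]_t ((abel g t)%:E * b t) <=
    \int[mu]_t ((abel g t)%:E * a t) + \int[mu]_t ((abel g (t - s)%R)%:E * b t))%E ->
  False.
Proof.
move=> /andP[g0 g1] d0 e0 ma mb a0 b0 fa fb near0 H.
have int0 (f : R -> R) c : (forall t, 0 <= f t) -> (forall t, 0 <= c t)%E ->
    (0 <= \int[mu]_t ((f t)%:E * c t))%E.
  by move=> f0 c0; apply: integral_ge0 => t _; rewrite mule_ge0 ?lee_fin.
pose A := fine (\int[mu]_t ((abel g t)%:E * a t))%E.
have AE : (\int[mu]_t ((abel g t)%:E * a t) = A%:E)%E.
  by rewrite fineK// ge0_fin_numE// int0//; exact: abel_ge0.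
have A0 : 0 <= A by apply/fine_ge0/int0 => //; exact: abel_ge0.
(* The common factor r ^ (- g) / g has been divided out. *)
suff key r : 0 < r < delta -> eta * (r `^ g / g) <= r / delta * A.
  (* [key] asks for eta * delta / g <= r ^ (1 - g) * A, and r is chosen such that
     r ^ (1 - g) <= X^-1 = eta * delta / (g * (A + 1)). *)
  pose X := (A + 1) * g / (eta * delta).
  have X0 : 0 < X by rewrite divr_gt0 ?mulr_gt0//; lra.
  pose rho := X `^ (- (1 - g)^-1).
  have rho0 : 0 < rho by rewrite powR_gt0.
  pose r := Num.min (delta / 2) rho.
  have r0 : 0 < r by rewrite lt_min rho0 divr_gt0.
  have rd : r < delta by rewrite gt_min; apply/orP; left; lra.
  have rE : r = r `^ g * r `^ (1 - g).
    by rewrite -powRD ?(gt_eqF r0) ?implybT// addrC subrK powRr1// ltW.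
  have H2 : eta * (r `^ g / g) <= r / delta * A by apply: key; rewrite r0 rd.
  rewrite [X in _ <= X / _ * _]rE in H2.
  have : r `^ (1 - g) <= X^-1.
    rewrite -(powR_inv1 (ltW X0)) (_ : -1 = (- (1 - g)^-1) * (1 - g)); last first.
      by field; rewrite subr_eq0 gt_eqF.
    rewrite powRrM; apply: ge0_ler_powR; rewrite ?nnegrE ?powR_ge0 ?(ltW r0)//; first lra.
    by rewrite ge_min lexx orbT.
  have rg0 : 0 < r `^ g by rewrite powR_gt0.
  move: (r `^ g) (r `^ (1 - g)) rg0 H2 => x y x0 H2 yX.
  have {}H2 : eta * delta / g <= y * A.
    rewrite -(ler_pM2l x0) -(ler_pM2r (x:=delta^-1)) ?invr_gt0//.
    rewrite [leLHS](_ : _ = eta * (x / g)); last by field; rewrite !gt_eqF.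
    rewrite [leRHS](_ : _ = x * y / delta * A); last by ring.
    exact: H2.
  have : eta * delta / g <= X^-1 * A by apply: le_trans H2 _; rewrite ler_wpM2r.
  rewrite /X invf_div -mulrA [X in _ <= X]mulrC !mulrA ler_pdivlMr ?mulr_gt0 ?ltr_wpDl//.
  rewrite [leLHS](_ : _ = eta * delta * (A + 1)); last by field; rewrite gt_eqF.
  have : 0 < eta * delta by rewrite mulr_gt0.
  nra.
move=> /andP[r0 rd].
pose M := r `^ (- g) / g.
have M0 : 0 < M by rewrite divr_gt0// powR_gt0.
pose psi := levy_abel g r; pose phi t := M * abel g t - levy_abel g r t.
have phi0 t : 0 <= phi t by rewrite subr_ge0 levy_abel_le.
have mphi : measurable_fun setT phi.
  apply: measurable_funB; last exact: measurable_levy_abel.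
  by apply: measurable_funM => //; exact: measurable_abel.
have phiD t : psi t + phi t = M * abel g t by rewrite addrC subrK.
have phile t : phi t <= M * abel g t by rewrite lerBlDr lerDl levy_abel_ge0.
have fM (c : R -> \bar R) : measurable_fun setT c -> (forall t, 0 <= c t)%E ->
    (\int[mu]_t ((M * abel g t)%R%:E * c t) = M%:E * \int[mu]_t ((abel g t)%:E * c t))%E.
  move=> mc c0; rewrite -ge0_integralZl//.
  - by apply: eq_integral => t _; rewrite EFinM muleA.
  - by apply: measurable_EFin_mul => //; exact: measurable_abel.
  - by move=> t _; rewrite mule_ge0// lee_fin abel_ge0.
  - by rewrite lee_fin ltW.
have le_fin (f : R -> R) (c : R -> \bar R) : measurable_fun setT c ->
  (forall t, 0 <= c t)%E ->
    measurable_fun setT f -> (forall t, 0 <= f t) -> (forall t, f t <= M * abel g t) ->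
    (\int[mu]_t ((abel g t)%:E * c t) < +oo -> \int[mu]_t ((f t)%:E * c t) < +oo)%E.
  move=> mc c0 mf f0 fle fc.
  apply: (@le_lt_trans _ _ (M%:E * \int[mu]_t ((abel g t)%:E * c t))%E); last first.
    by rewrite lte_mul_pinfty// ?lee_fin ?ltW.
  rewrite -fM//; apply: ge0_le_integral => //.
  - by move=> t _; rewrite mule_ge0 ?lee_fin.
  - exact: measurable_EFin_mul.
  - by apply: measurable_EFin_mul => //; apply: measurable_funM => //;
      exact: measurable_abel.
  - by move=> t _; apply: lee_wpmul2r; rewrite ?lee_fin.
have mpsi : measurable_fun setT psi by exact: measurable_levy_abel.
have psi0 t : 0 <= psi t by exact: levy_abel_ge0.
have psile t : psi t <= M * abel g t by exact: levy_abel_le.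
have := @separation_weight_le R psi phi a b delta eta d0 e0 mpsi mphi ma mb psi0 phi0
  _ a0 b0 (le_fin _ _ ma a0 mpsi psi0 psile fa) (le_fin _ _ mb b0 mpsi psi0 psile fb)
    (le_fin _ _ ma a0 mphi phi0 phile fa) _ near0.
have phiN : (forall t, t <= 0 -> phi t = 0).
  by move=> t t0; rewrite /phi /abel /levy_abel !ifN ?mulr0 ?subr0// -leNgt; lra.
have lev0 s : (0 <= (levy g r s)%:E)%E by rewrite lee_fin levy_ge0.
have intM (c : \bar R) : (0 <= c)%E ->
    (\int[mu]_s ((levy g r s)%:E * c) = M%:E * c)%E.
  move=> c0; rewrite ge0_integralZr//; first by rewrite integral_levy.
  by apply/measurable_EFinP; exact: measurable_levy.
have I0 (c : R -> \bar R) s : (forall t, 0 <= c t)%E ->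
    (0 <= \int[mu]_t ((abel g (t - s)%R)%:E * c t))%E.
  by move=> c0; apply: (int0 (fun t => abel g (t - s))) => // t; exact: abel_ge0.
have J0 (c : R -> \bar R) : (forall t, 0 <= c t)%E ->
    (0 <= \int[mu]_t ((abel g t)%:E * c t))%E.
  by move=> c0; apply: int0 => // t; exact: abel_ge0.
have msum (c : R -> \bar R) k : measurable_fun setT c -> (forall t, 0 <= c t)%E ->
  (0 <= k)%E ->
    (\int[mu]_s ((levy g r s)%:E * (\int[mu]_t ((abel g (t - s)%R)%:E * c t) + k)) =
     \int[mu]_t ((psi t)%:E * c t) + M%:E * k)%E.
  move=> mc c0 k0; rewrite -integral_levy_abel_shift// -(intM k)// -ge0_integralD//.
  - by apply: eq_integral => s _; rewrite ge0_muleDr// I0.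
  - by move=> s _; rewrite mule_ge0// I0.
  - by apply: measurable_EFin_mul; [exact: measurable_levy|exact: measurable_abel_conv].
  - by move=> s _; rewrite mule_ge0.
  - by apply: measurable_EFin_mul; [exact: measurable_levy|exact: measurable_cst].
have mmsum (c : R -> \bar R) k : measurable_fun setT c -> (forall t, 0 <= c t)%E ->
    measurable_fun setT (fun s => (levy g r s)%:E * (\int[mu]_t ((abel g (t -
      s)%R)%:E * c t) + k))%E.
  move=> mc c0; apply: measurable_EFin_mul; first exact: measurable_levy.
  by apply: emeasurable_funD; [exact: measurable_abel_conv|exact: measurable_cst].
have Hlev : (\int[mu]_t ((psi t)%:E * a t) + \int[mu]_t ((psi t + phi t)%:E * b t) <=
    \int[mu]_t ((psi t + phi t)%:E * a t) + \int[mu]_t ((psi t)%:E * b t))%E.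
  under [X in (_ + X <= _)%E]eq_integral do rewrite phiD.
  under [X in (_ <= X + _)%E]eq_integral do rewrite phiD.
  rewrite (fM a ma a0) (fM b mb b0) [leRHS]addeC.
  rewrite -(msum a _ ma a0 (J0 b b0)) -(msum b _ mb b0 (J0 a a0)).
  apply: ge0_le_integral => //.
  - by move=> s _; rewrite mule_ge0// adde_ge0// ?I0// J0.
  - exact: mmsum.
  - exact: mmsum.
  - move=> s _; rewrite /levy; case: ifPn => rs; last by rewrite !mul0e.
    apply: lee_wpmul2l; first by rewrite lee_fin powR_ge0.
    by rewrite [leRHS]addeC; apply: H; lra.
move=> /(_ phiN Hlev) Hcmp.
have lo : ((M * (r `^ g / g))%:E <= \int[mu]_(t in `]0%R, delta[) (phi t)%:E)%E.
  apply: (@le_trans _ _ (\int[mu]_(t in `]0%R, r[) (phi t)%:E)%E); last first.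
    apply: ge0_subset_integral => //.
    - by apply/measurable_EFinP; exact: (measurable_funS measurableT).
    - by move=> t _; rewrite lee_fin.
    - by move=> t /=; rewrite !in_itv/=; lra.
  rewrite EFinM -integral_powR_near0// -ge0_integralZl//.
  - apply: ge0_le_integral => //.
    + by move=> t _; rewrite mule_ge0// lee_fin ?powR_ge0// ltW.
    + apply/measurable_EFinP; apply: (measurable_funS measurableT) => //.
      by apply: measurable_funM => //; exact: measurable_powR.
    + by apply/measurable_EFinP; exact: (measurable_funS measurableT).
    + move=> t; rewrite /= in_itv/= => /andP[t0 tr].
      by rewrite -EFinM lee_fin /phi /levy_abel ltNge (ltW tr)/= subr0 /abel t0.
  - by apply/measurable_EFinP; apply: (@measurable_funS _ _ _ _ setT).
  - by move=> t _; rewrite lee_fin powR_ge0.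
  - by rewrite lee_fin ltW.
have hi : (\int[mu]_(t in `[delta, +oo[) ((phi t)%:E * a t) <= (M * (r / delta *
  A))%:E)%E.
  have c0 : 0 <= M * (r / delta) by apply: mulr_ge0; [exact: ltW|apply: divr_ge0;
    exact: ltW].
  rewrite mulrA EFinM -AE.
  apply: (@le_trans _ _ (\int[mu]_(t in `[delta, +oo[) ((M * (r / delta))%:E * ((abel
    g t)%:E * a t)))%E).
    apply: ge0_le_integral => //.
    - by move=> t _; rewrite mule_ge0 ?lee_fin.
    - by apply: (measurable_funS measurableT) => //; exact: measurable_EFin_mul.
    - apply: (measurable_funS measurableT) => //; apply: measurable_EFin_mul => //.
      by apply: measurable_EFin_mul => //; exact: measurable_abel.
    - move=> t; rewrite /= in_itv/= andbT => dt; rewrite muleA -EFinM.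
      apply: lee_wpmul2r => //; rewrite lee_fin.
      have g1' : 0 < g <= 1 by rewrite g0 ltW.
      have t0 : 0 < t by lra.
      have := @levy_abel_ge _ g r t g1' r0; rewrite -/M => /(_ (lt_le_trans rd dt)) Hge.
      rewrite /phi lerBlDl; apply: le_trans (_ : _ <= M * abel g t * (1 - r / t) + M
        * abel g t * (r / t)) _.
        by rewrite -mulrDr subrK mulr1.
      apply: lerD => //; rewrite -mulrA [leRHS]mulrAC -mulrA ler_wpM2l ?(ltW M0)//.
      apply: ler_wpM2l; first exact: abel_ge0.
      by rewrite ler_pM2l// lef_pV2 ?posrE.
  rewrite ge0_integralZl//.
  - apply: lee_wpmul2l; first by rewrite lee_fin.
    apply: ge0_subset_integral => //.
    + by apply: measurable_EFin_mul => //; exact: measurable_abel.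
    + by move=> t _; rewrite mule_ge0// lee_fin abel_ge0.
  - apply: (measurable_funS measurableT) => //.
    by apply: measurable_EFin_mul => //; exact: measurable_abel.
  - by move=> t _; rewrite mule_ge0// lee_fin abel_ge0.
have := le_trans (lee_wpmul2l (_ : 0 <= eta%:E)%E lo) (le_trans Hcmp hi).
rewrite !lee_fin => /(_ (ltW e0)).
by rewrite mulrCA ler_pM2l.
Qed.

(** Here the kernel is the indicator of t > 0, so that a single shift, by
    s < delta, compares the integrals of a and b over ]0, s]. *)
Lemma no_separation_eq1 (a b : R -> \bar R) (delta eta : R) :
  0 < delta -> 0 < eta ->
  measurable_fun setT a -> measurable_fun setT b ->
  (forall t, 0 <= a t)%E -> (forall t, 0 <= b t)%E ->
  (\int[mu]_t ((abel 1 t)%:E * a t) < +oo)%E ->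
  (\int[mu]_t ((abel 1 t)%:E * b t) < +oo)%E ->
  (forall t : R, (0 < t < delta)%R -> (a t + eta%:E <= b t)%E) ->
  (forall s : R, (0 < s)%R ->
    \int[mu]_t ((abel 1 (t - s)%R)%:E * a t) + \int[mu]_t ((abel 1 t)%:E * b t) <=
    \int[mu]_t ((abel 1 t)%:E * a t) + \int[mu]_t ((abel 1 (t - s)%R)%:E * b t))%E ->
  False.
Proof.
move=> d0 e0 ma mb a0 b0 fa fb near0 H.
have k1 (t : R) : abel 1 t = (0 < t)%R%:R by rewrite /abel subrr powRr0; case: ifP.
pose s := delta / 2; have s0 : 0 < s by rewrite divr_gt0.
pose psi t := abel 1 (t - s); pose phi t := abel 1 t - abel 1 (t - s).
have phiE t : phi t = (0 < t <= s)%R%:R.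
  rewrite /phi !k1 subr_gt0; case: (ltP 0 t) => t0; case: (leP t s) => ts;
    rewrite ?subr0 ?subrr//.
  by exfalso; lra.
have phi0 t : 0 <= phi t by rewrite phiE.
have psi0 t : 0 <= psi t by rewrite /psi k1.
have phiD t : psi t + phi t = abel 1 t by rewrite addrC subrK.
have mpsi : measurable_fun setT psi by exact: measurable_abel_shift.
have mphi : measurable_fun setT phi.
  by apply: measurable_funB => //; exact: measurable_abel.
have le_fin (f : R -> R) (c : R -> \bar R) : measurable_fun setT c ->
  (forall t, 0 <= c t)%E ->
    measurable_fun setT f -> (forall t, 0 <= f t) -> (forall t, f t <= abel 1 t) ->
    (\int[mu]_t ((abel 1 t)%:E * c t) < +oo -> \int[mu]_t ((f t)%:E * c t) < +oo)%E.
  move=> mc c0 mf f0 fle fc; apply: le_lt_trans fc; apply: ge0_le_integral => //.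
  - by move=> t _; rewrite mule_ge0 ?lee_fin.
  - exact: measurable_EFin_mul.
  - by apply: measurable_EFin_mul => //; exact: measurable_abel.
  - by move=> t _; apply: lee_wpmul2r; rewrite ?lee_fin.
have phile t : phi t <= abel 1 t by rewrite -phiD lerDr.
have psile t : psi t <= abel 1 t by rewrite -phiD lerDl.
have phiN t : t <= 0 -> phi t = 0 by move=> t0; rewrite phiE ltNge t0.
have Hs : (\int[mu]_t ((psi t)%:E * a t) + \int[mu]_t ((psi t + phi t)%:E * b t) <=
    \int[mu]_t ((psi t + phi t)%:E * a t) + \int[mu]_t ((psi t)%:E * b t))%E.
  under [X in (_ + X <= _)%E]eq_integral do rewrite phiD.
  under [X in (_ <= X + _)%E]eq_integral do rewrite phiD.
  exact: H.
have := @separation_weight_le R psi phi a b delta eta d0 e0 mpsi mphi ma mb psi0 phi0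
  phiN a0 b0 (le_fin _ _ ma a0 mpsi psi0 psile fa) (le_fin _ _ mb b0 mpsi psi0 psile
    fb) (le_fin _ _ ma a0 mphi phi0 phile fa) Hs near0.
rewrite [leRHS]integral0_eq; last first.
  move=> t; rewrite /= in_itv/= andbT => dt; rewrite phiE.
  by rewrite (_ : (0 < t <= s) = false) ?mul0e//; apply/negbTE/negP; rewrite /s; lra.
apply/negP; rewrite -ltNge mule_gt0 ?lte_fin//.
apply: (@lt_le_trans _ _ (\int[mu]_(t in `]0%R, s[) (cst 1%E t))%E).
  by rewrite integral_cst//= mul1e lebesgue_measure_itv/= lte_fin s0 oppr0 adde0 lte_fin.
apply: (@le_trans _ _ (\int[mu]_(t in `]0%R, s[) (phi t)%:E)%E).
  apply: ge0_le_integral => //.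
  - by apply/measurable_EFinP; exact: (measurable_funS measurableT).
  - by move=> t; rewrite /= in_itv/= => /andP[t0 ts]; rewrite phiE t0 (ltW ts).
apply: ge0_subset_integral => //.
- by apply/measurable_EFinP; exact: (measurable_funS measurableT).
- by move=> t _; rewrite lee_fin.
- by move=> t /=; rewrite !in_itv/= /s; lra.
Qed.
End no_separation.

(** * Integration in coordinates and the one-dimensional heat kernel *)

Section product_integrals.
Context {R : realType}.
Local Notation mu := (@lebesgue_measure R).

Lemma rV_cons_head n (p : measurableTypeR R * 'rV[R]_n) :
  rV_cons p ord0 ord0 = p.1.
Proof. by rewrite -[RHS](congr1 fst (rV_consK p)). Qed.

Lemma rV_cons_tail n (p : measurableTypeR R * 'rV[R]_n) i :
  rV_cons p ord0 (lift ord0 i) = p.2 ord0 i.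
Proof.
transitivity (row_mx (p.1 : R)%:M p.2 ord0 (rshift 1 i)).
  by congr (row_mx _ _ _ _); exact: val_inj.
by rewrite row_mxEr.
Qed.

Lemma measurable_rV_entry n (i : 'I_n) :
  measurable_fun setT (fun x : 'rV[R]_n => x ord0 i).
Proof. exact: (@measurable_rV_coord R n i). Qed.

Lemma measurable_rV_box n (A : 'I_n -> set R) :
  (forall i, measurable (A i)) ->
  measurable [set x : 'rV[R]_n | forall i, A i (x ord0 i)].
Proof.
move=> mA; rewrite (_ : mkset _ =
    \bigcap_(i in [set: 'I_n]) ((fun x : 'rV[R]_n => x ord0 i) @^-1` A i)).
  apply: fin_bigcap_measurable; first exact: finite_finset.
  move=> i _; rewrite -[X in measurable X]setTI.
  by apply: (@measurable_rV_entry n i) => //; exact: mA.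
by apply/seteqP; split=> [x Ax i _|x Ax i]; exact: Ax.
Qed.

Lemma integral_lebesgue_rVS n (f : 'rV[R]_n.+1 -> \bar R) :
  measurable_fun setT f -> (forall x, 0 <= f x)%E ->
  (\int[lebesgue_rV R n.+1]_x f x =
   \int[mu]_s \int[lebesgue_rV R n]_v f (rV_cons (s, v)))%E.
Proof.
move=> mf f0.
transitivity (\int[pushforward (mu \x lebesgue_rV R n)%E (@rV_cons R n)]_x f x)%E.
  exact: eq_measure_integral.
rewrite (ge0_integral_pushforward (@measurable_rV_cons R n))//.
rewrite preimage_setT fubini_tonelli1//.
  by apply: measurableT_comp => //; exact: measurable_rV_cons.
by move=> p; exact: f0.
Qed.

Lemma integral_prod_rV n (g : 'I_n -> R -> R) (c : 'I_n -> R) :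
  (forall i, measurable_fun setT (g i)) -> (forall i y, 0 <= g i y) ->
  (forall i, \int[mu]_y (g i y)%:E = (c i)%:E)%E ->
  (\int[lebesgue_rV R n]_x (\prod_i g i (x ord0 i))%:E = (\prod_i c i)%:E)%E.
Proof.
elim: n g c => [|n IH] g c mg g0 gc.
  rewrite /= integral_dirac//; last first.
    apply/measurable_EFinP; apply: measurable_prod => i _.
    by apply: measurableT_comp => //; exact: measurable_rV_entry.
  by rewrite diracT mul1e !big_ord0.
rewrite integral_lebesgue_rVS; last 2 first.
- apply/measurable_EFinP; apply: measurable_prod => i _.
  by apply: (measurableT_comp (mg i)); exact: measurable_rV_entry.
- by move=> x; rewrite lee_fin prodr_ge0.
have mp : measurable_fun setT (fun v : 'rV[R]_n => \prod_i g (lift ord0 i) (v ord0 i)).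
  apply: measurable_prod => i _.
  by apply: (measurableT_comp (mg _)); exact: measurable_rV_entry.
transitivity (\int[mu]_s ((g ord0 s)%:E * (\prod_i c (lift ord0 i))%:E))%E.
  apply: eq_integral => s _.
  rewrite -(IH (fun i => g (lift ord0 i)))// -ge0_integralZl//.
  - apply: eq_integral => v _; rewrite big_ord_recl rV_cons_head -EFinM.
    by congr ((_ * _)%:E); apply: eq_bigr => i _; rewrite rV_cons_tail.
  - exact/measurable_EFinP.
  - by move=> v _; rewrite lee_fin prodr_ge0.
  - by rewrite lee_fin.
rewrite ge0_integralZr//.
- by rewrite gc -EFinM big_ord_recl.
- by apply/measurable_EFinP; exact: mg.
- by move=> s _; rewrite lee_fin.
- have := @integral_ge0 _ _ _ (lebesgue_rV R n) setT (fun v : 'rV[R]_n => (\prod_i g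
    (lift ord0 i) (v ord0 i))%:E).
  by rewrite (IH (fun i => g (lift ord0 i)) (fun i => c (lift ord0 i)))//;
    apply=> v _; rewrite lee_fin prodr_ge0.
Qed.

Definition heat1 (t y : R) : R :=
  (2 * pi * t) `^ (- 2^-1) * expR (- y ^+ 2 / (2 * t)).

Lemma heat1_ge0 t y : 0 <= heat1 t y.
Proof. by rewrite mulr_ge0 ?powR_ge0 ?expR_ge0. Qed.

Lemma heat1_normal t m y : 0 < t ->
  heat1 t (y - m) = normal_pdf m (Num.sqrt t) y.
Proof.
move=> t0; rewrite normal_pdfE; last by rewrite gt_eqF// sqrtr_gt0.
rewrite /normal_peak /normal_fun sqr_sqrtr ?ltW// /heat1.
congr (_ * _); last by congr (expR (_ / _)); rewrite mulr_natl.
rewrite powRN powR12_sqrt; last by rewrite !mulr_ge0 ?pi_ge0// ltW.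
by congr ((Num.sqrt _)^-1); rewrite -mulr_natl; ring.
Qed.

Lemma measurable_heat1 (t m : R) : measurable_fun setT (fun y : R => heat1 t (y - m)).
Proof.
apply: measurable_funM => //; apply: measurableT_comp => //.
apply: measurable_funM => //; apply: measurableT_comp => //.
by apply: measurable_funX; exact: measurable_funB.
Qed.

Lemma integral_heat1 (t m : R) : (0 < t)%R -> (\int[mu]_y (heat1 t (y - m)%R)%:E = 1)%E.
Proof.
move=> t0; rewrite -(@integral_normal_pdf R m (Num.sqrt t)).
by apply: eq_integral => y _; rewrite heat1_normal.
Qed.

(** Completion of the square in y. *)
Lemma heat1_conv (s t x y z : R) : 0 < s -> 0 < t ->
  heat1 s (x - y) * heat1 t (y - z) =
  heat1 (s + t) (x - z) * heat1 (s * t / (s + t)) (y - (t * x + s * z) / (s + t)).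
Proof.
move=> s0 t0; rewrite /heat1.
have st0 : 0 < s + t by rewrite addr_gt0.
have n0 : [&& s != 0, t != 0 & s + t != 0] by rewrite !gt_eqF.
rewrite mulrACA -expRD -powRM ?mulr_ge0 ?pi_ge0 ?ltW//.
rewrite [RHS]mulrACA -expRD -powRM ?mulr_ge0 ?pi_ge0 ?ltW ?invr_gt0//.
case/and3P: n0 => ns nt nst.
congr (_ `^ _ * expR _); field; by rewrite ?ns ?nt ?nst.
Qed.

Lemma heat1_semigroup (s t x z : R) : 0 < s -> 0 < t ->
  (\int[mu]_y (heat1 s (x - y) * heat1 t (y - z))%R%:E =
   (heat1 (s + t)%R (x - z)%R)%:E)%E.
Proof.
move=> s0 t0; under eq_integral do rewrite heat1_conv// EFinM.
rewrite ge0_integralZl//.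
- by rewrite integral_heat1 ?mule1// divr_gt0 ?mulr_gt0 ?addr_gt0.
- by apply/measurable_EFinP; exact: measurable_heat1.
- by move=> y _; rewrite lee_fin heat1_ge0.
- by rewrite lee_fin heat1_ge0.
Qed.

End product_integrals.

(** * The heat semigroup and its Riesz potentials *)

Section heat.
Context {R : realType} {d : nat}.
Local Notation mu := (@lebesgue_measure R).
Local Notation lam := (lebesgue_rV R d).
Implicit Types (s t : R) (x y z : 'rV[R]_d) (f : 'rV[R]_d -> R).

Definition sqnorm x : R := \sum_i x ord0 i ^+ 2.

Definition heat t x : R :=
  (2 * pi * t) `^ (- (d%:R / 2)) * expR (- sqnorm x / (2 * t)).

Lemma sqnorm_ge0 x : 0 <= sqnorm x.
Proof. by apply: sumr_ge0 => i _; exact: sqr_ge0. Qed.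

Lemma heat_ge0 t x : 0 <= heat t x.
Proof. by rewrite mulr_ge0 ?powR_ge0 ?expR_ge0. Qed.

Lemma heat_prod t x : heat t x = \prod_i heat1 t (x ord0 i).
Proof.
rewrite /heat1 big_split/= prodr_const card_ord -expR_sum.
congr (_ * expR _).
  by rewrite -powR_mulrn ?powR_ge0// -powRrM; congr (_ `^ _); rewrite mulNr mulrC.
rewrite /sqnorm -sumrN mulr_suml; apply: eq_bigr => i _; by [].
Qed.

Lemma measurable_sqnorm d' (T : measurableType d') (u v : T -> 'rV[R]_d) :
  measurable_fun setT u -> measurable_fun setT v ->
  measurable_fun setT (fun p => sqnorm (u p - v p)).
Proof.
move=> mu' mv; apply: measurable_sum => i; apply: measurable_funX.
have -> : (fun p => (u p - v p) ord0 i) = (fun p => u p ord0 i - v p ord0 i).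
  by apply/funext => p; rewrite !mxE.
apply: measurable_funB.
- by apply: (measurableT_comp (measurable_rV_entry i)).
- by apply: (measurableT_comp (measurable_rV_entry i)).
Qed.

Lemma measurable_heat d' (T : measurableType d') (h : T -> R) (u v : T -> 'rV[R]_d) :
  measurable_fun setT h -> measurable_fun setT u -> measurable_fun setT v ->
  measurable_fun setT (fun p => heat (h p) (u p - v p)).
Proof.
move=> mh mu' mv; apply: measurable_funM.
  apply: (measurableT_comp (@measurable_powR R _)).
  exact: measurable_funM.
apply: measurableT_comp => //; apply: measurable_funM.
  by apply: measurableT_comp => //; exact: measurable_sqnorm.
by apply: measurable_invr; exact: measurable_funM.
Qed.

Lemma heatC t x y : heat t (x - y) = heat t (y - x).
Proof.
rewrite /heat; suff -> : sqnorm (x - y) = sqnorm (y - x) by [].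
by apply: eq_bigr => i _; rewrite !mxE -sqrrN opprB.
Qed.

Lemma integral_heat t x : 0 < t -> (\int[lam]_y (heat t (x - y)%R)%:E = 1)%E.
Proof.
move=> t0.
have := @integral_prod_rV R d (fun i u => heat1 t (u - x ord0 i)) (fun=> 1).
rewrite prodr_const expr1n => <-.
- apply: eq_integral => y _; congr (_%:E); rewrite heatC heat_prod.
  by apply: eq_bigr => i _; rewrite !mxE.
- by move=> i; exact: measurable_heat1.
- by move=> i y; exact: heat1_ge0.
- by move=> i; exact: integral_heat1.
Qed.

Lemma heat_semigroup s t x z : 0 < s -> 0 < t ->
  (\int[lam]_y (heat s (x - y) * heat t (y - z))%R%:E = (heat (s + t)%R (x - z)%R)%:E)%E.
Proof.
move=> s0 t0; rewrite heat_prod.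
under [in RHS]eq_bigr do rewrite !mxE.
have H := @integral_prod_rV R d
  (fun i u => heat1 s (x ord0 i - u) * heat1 t (u - z ord0 i))
  (fun i => heat1 (s + t) (x ord0 i - z ord0 i)).
rewrite -H.
- apply: eq_integral => y _; congr (_%:E); rewrite !heat_prod -big_split/=.
  by apply: eq_bigr => i _; rewrite !mxE.
- move=> i; apply: measurable_funM; last exact: measurable_heat1.
  have -> : (fun u => heat1 s (x ord0 i - u)) = (fun u => heat1 s (u - x ord0 i)).
    by apply/funext => u; rewrite /heat1 -sqrrN opprB.
  exact: measurable_heat1.
- by move=> i y; rewrite mulr_ge0 ?heat1_ge0.
- by move=> i; exact: heat1_semigroup.
Qed.

Lemma heat_le t x : 0 < t -> heat t x <= (2 * pi * t) `^ (- (d%:R / 2)).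
Proof.
move=> t0; rewrite /heat ler_piMr ?powR_ge0// -expR0 ler_expR.
by rewrite mulNr oppr_le0 divr_ge0 ?sqnorm_ge0// mulr_ge0// ltW.
Qed.

(** Half of the exponent absorbs the factor |x| ^ 2, by u <= expR u at
    u = |x| ^ 2 / (4 t). Integrated over x, this bounds the second moment of the
    heat kernel by a multiple of t. *)
Lemma sqnorm_heat_le t x : 0 < t ->
  sqnorm x * heat t x <= 4 * t * 2 `^ (d%:R / 2) * heat (2 * t) x.
Proof.
move=> t0; rewrite /heat.
have -> : (2 * pi * (2 * t)) `^ (- (d%:R / 2)) =
    2 `^ (- (d%:R / 2)) * (2 * pi * t) `^ (- (d%:R / 2)).
  rewrite -powRM//; first by congr (_ `^ _); ring.
  by rewrite !mulr_ge0 ?pi_ge0// ltW.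
rewrite [2 `^ (- _)]powRN.
have h0 : 2 `^ (d%:R / 2) != 0 :> R by rewrite gt_eqF ?powR_gt0.
rewrite [leRHS](_ : _ = (2 * pi * t) `^ (- (d%:R / 2)) *
    (4 * t * expR (- sqnorm x / (2 * (2 * t))))); last by field.
rewrite mulrCA ler_wpM2l ?powR_ge0//.
set q := sqnorm x.
have -> : - q / (2 * t) = - q / (2 * (2 * t)) + - q / (2 * (2 * t)).
  by field; rewrite gt_eqF.
rewrite expRD [leLHS]mulrA; apply: ler_wpM2r; first exact: expR_ge0.
rewrite mulNr expRN ler_pdivrMr ?expR_gt0//.
apply: (@le_trans _ _ (4 * t * (q / (2 * (2 * t))))).
  by rewrite le_eqVlt; apply/orP; left; apply/eqP; field; rewrite gt_eqF.
rewrite ler_wpM2l ?mulr_ge0 ?(ltW t0)//.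
by apply: le_trans (expR_ge1Dx _); rewrite lerDr.
Qed.

Definition heat_op f t x : \bar R := (\int[lam]_y (f y * heat t (x - y))%R%:E)%E.

Lemma heat_op_ge0 f t x : (forall y, 0 <= f y) -> (0 <= heat_op f t x)%E.
Proof.
by move=> f0; apply: integral_ge0 => y _; rewrite lee_fin mulr_ge0 ?heat_ge0.
Qed.

Lemma measurable_heat_op d' (T : measurableType d') (h : T -> R) (u : T -> 'rV[R]_d) f :
  measurable_fun setT f -> (forall y, 0 <= f y) ->
  measurable_fun setT h -> measurable_fun setT u ->
  measurable_fun setT (fun p => heat_op f (h p) (u p)).
Proof.
move=> mf f0 mh mu'.
apply: (@measurable_fun_fubini_tonelli_F _ _ _ _ _ lam
  (fun p : T * 'rV[R]_d => (f p.2 * heat (h p.1) (u p.1 - p.2))%R%:E)).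
- apply/measurable_EFinP; apply: measurable_funM.
    exact: (measurableT_comp mf measurable_snd).
  apply: measurable_heat.
  + exact: (measurableT_comp mh measurable_fst).
  + exact: (measurableT_comp mu' measurable_fst).
  + exact: measurable_snd.
- by move=> p; rewrite lee_fin mulr_ge0 ?heat_ge0.
Qed.

Lemma heat_op_semigroup f s t x0 : measurable_fun setT f -> (forall y, 0 <= f y) ->
  0 < s -> 0 < t ->
  (\int[lam]_x ((heat s (x0 - x)%R)%:E * heat_op f t x) = heat_op f (s + t)%R x0)%E.
Proof.
move=> mf f0 s0 t0; rewrite /heat_op.
transitivity (\int[lam]_x \int[lam]_y (heat s (x0 - x) * (f y * heat t (x - y)))%R%:E)%E.
  apply: eq_integral => x _; rewrite -ge0_integralZl//.
  - apply/measurable_EFinP; apply: measurable_funM => //.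
    by apply: measurable_heat => //; exact: measurable_cst.
  - by move=> y _; rewrite lee_fin mulr_ge0 ?heat_ge0.
  - by rewrite lee_fin heat_ge0.
rewrite (@fubini_tonelli _ _ _ _ _ lam lam (fun p : 'rV[R]_d * 'rV[R]_d =>
    (heat s (x0 - p.1) * (f p.2 * heat t (p.1 - p.2)))%R%:E)%E)/=.
- apply: eq_integral => y _; rewrite EFinM -heat_semigroup// -ge0_integralZl//.
  + by apply: eq_integral => x _; rewrite -EFinM mulrCA.
  + apply/measurable_EFinP; apply: measurable_funM.
      by apply: measurable_heat => //; exact: measurable_cst.
    by apply: measurable_heat => //; exact: measurable_cst.
  + by move=> x _; rewrite lee_fin mulr_ge0 ?heat_ge0.
  + by rewrite lee_fin.
- apply/measurable_EFinP; apply: measurable_funM.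
    by apply: measurable_heat; [exact: measurable_cst|exact: measurable_cst|exact:
      measurable_fst].
  apply: measurable_funM; first exact: (measurableT_comp mf measurable_snd).
  by apply: measurable_heat; [exact: measurable_cst|exact: measurable_fst|exact:
    measurable_snd].
- move=> p; rewrite lee_fin; apply: mulr_ge0; first exact: heat_ge0.
  by apply: mulr_ge0; [exact: f0|exact: heat_ge0].
Qed.

(** Up to a constant, the Riesz potential of order 2 g, see [riesz_potE]. *)
Definition riesz_pot g f x : \bar R := (\int[mu]_t ((abel g t)%:E * heat_op f t x))%E.

Lemma riesz_pot_ge0 g f x : (forall y, 0 <= f y) -> (0 <= riesz_pot g f x)%E.
Proof.
move=> f0; apply: integral_ge0 => t _.
by apply: mule_ge0; [rewrite lee_fin; exact: abel_ge0|exact: heat_op_ge0].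
Qed.

Lemma measurable_riesz_pot g f : measurable_fun setT f -> (forall y, 0 <= f y) ->
  measurable_fun setT (riesz_pot g f).
Proof.
move=> mf f0.
apply: (@measurable_fun_fubini_tonelli_F _ _ _ _ _ mu
  (fun p : 'rV[R]_d * R => (abel g p.2)%:E * heat_op f p.2 p.1)%E).
- apply: measurable_EFin_mul.
    exact: (measurableT_comp (measurable_abel g) measurable_snd).
  by apply: measurable_heat_op.
- move=> p.
  by apply: mule_ge0; [rewrite lee_fin; exact: abel_ge0|exact: heat_op_ge0].
Qed.

(** The left-hand side is the integral of [abel g t] P_(s + t) f x0 by the
    semigroup property; then t is shifted by s. *)
Lemma heat_riesz_pot g f s x0 : measurable_fun setT f -> (forall y, 0 <= f y) -> 0 < s ->
  (\int[lam]_x ((heat s (x0 - x)%R)%:E * riesz_pot g f x) =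
   \int[mu]_t ((abel g (t - s)%R)%:E * heat_op f t x0))%E.
Proof.
move=> mf f0 s0.
have mh0 : measurable_fun setT (fun t : R => heat_op f t x0).
  by apply: measurable_heat_op => //; exact: measurable_cst.
have k0 t : (0 <= (abel g t)%:E)%E by rewrite lee_fin; exact: abel_ge0.
rewrite [RHS](@ge0_integral_affine R _ 1 s)//; last 2 first.
- apply: measurable_EFin_mul => //.
  by apply: (measurableT_comp (measurable_abel g)); exact: measurable_funB.
- by move=> t; apply: mule_ge0 => //; exact: heat_op_ge0.
rewrite mul1e /riesz_pot.
transitivity (\int[lam]_x \int[mu]_t ((heat s (x0 - x))%R%:E * ((abel g t)%:E *
  heat_op f t x)))%E.
  apply: eq_integral => x _; rewrite -ge0_integralZl//.
  - apply: measurable_EFin_mul; first exact: measurable_abel.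
    by apply: measurable_heat_op => //; exact: measurable_cst.
  - by move=> t _; apply: mule_ge0 => //; exact: heat_op_ge0.
  - by rewrite lee_fin heat_ge0.
rewrite (@fubini_tonelli _ _ _ _ _ lam mu (fun p : 'rV[R]_d * R =>
    (heat s (x0 - p.1))%R%:E * ((abel g p.2)%:E * heat_op f p.2 p.1))%E)/=.
- apply: eq_integral => t _; rewrite mul1r addrK.
  rewrite /abel; case: ifPn => t0; last first.
    by rewrite mul0e integral0_eq// => x _; rewrite mul0e mule0.
  rewrite [t + s]addrC -heat_op_semigroup// -ge0_integralZl//.
  + by apply: eq_integral => x _; rewrite muleCA.
  + apply: measurable_EFin_mul; first by apply: measurable_heat => //;
      exact: measurable_cst.
    by apply: measurable_heat_op => //; exact: measurable_cst.
  + by move=> x _; apply: mule_ge0; [rewrite lee_fin heat_ge0|exact: heat_op_ge0].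
  + by rewrite lee_fin powR_ge0.
- apply: measurable_EFin_mul.
    by apply: measurable_heat; [exact: measurable_cst|exact: measurable_cst|exact:
      measurable_fst].
  apply: measurable_EFin_mul.
    exact: (measurableT_comp (measurable_abel g) measurable_snd).
  by apply: measurable_heat_op.
- move=> p; apply: mule_ge0; first by rewrite lee_fin heat_ge0.
  by apply: mule_ge0 => //; exact: heat_op_ge0.
Qed.

End heat.

Section heat_bounds.
Context {R : realType} {d : nat}.
Local Notation mu := (@lebesgue_measure R).
Local Notation lam := (lebesgue_rV R d).
Implicit Types (s t : R) (x y z : 'rV[R]_d) (f : 'rV[R]_d -> R).

(** Up to a constant, the size of P_t f for f bounded and integrable: f is bounded
    by its supremum, the heat kernel by a multiple of t ^ (- d / 2). *)
Definition heat_decay t : R := if t < 1 then 1 else t `^ (- (d%:R / 2)).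

Lemma heat_decay_ge0 t : 0 <= heat_decay t.
Proof. by rewrite /heat_decay; case: ifP => // _; exact: powR_ge0. Qed.

Lemma measurable_heat_decay : measurable_fun setT heat_decay.
Proof.
apply: measurable_fun_ifT.
- exact: measurable_fun_ltr.
- exact: measurable_cst.
- exact: measurable_powR.
Qed.

Lemma integral_abel_decay g : 0 < g < d%:R / 2 ->
  exists2 D : R, 0 <= D & (\int[mu]_t (abel g t * heat_decay t)%R%:E = D%:E)%E.
Proof.
move=> /andP[g0 gd].
have m0 : measurable_fun setT (fun t => (abel g t * heat_decay t)%R%:E).
  apply/measurable_EFinP; apply: measurable_funM; last exact: measurable_heat_decay.
  exact: measurable_abel.
have p0 t : (0 <= (abel g t * heat_decay t)%R%:E)%E.
  by rewrite lee_fin; apply: mulr_ge0; [exact: abel_ge0|exact: heat_decay_ge0].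
have UT : setT = `]-oo, 0%R] `|` (`]0%R, 1%R[ `|` `[1%R, +oo[) :> set R.
  by apply/seteqP; split=> t //= _; rewrite !in_itv/=; case: (leP t 0) => t0;
    [left|right; case: (ltP t 1) => td; [left|right]].
exists (1 `^ g / g + 1 `^ (- (d%:R / 2 - g)) / (d%:R / 2 - g)).
  by rewrite addr_ge0// divr_ge0 ?powR_ge0// ?ltW// subr_gt0.
rewrite [in LHS]UT ge0_integral_setU//=; last 3 first.
- by apply: measurableU; exact: measurable_itv.
- by apply: (@measurable_funS _ _ _ _ setT).
- by apply/disj_setPS => t [] /= + []; rewrite !in_itv/=; lra.
rewrite [X in (X + _)%E]integral0_eq ?add0e; last first.
  by move=> t; rewrite /= in_itv/= => t0; rewrite /abel ltNge t0/= mul0r.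
rewrite ge0_integral_setU//=; last 2 first.
- by apply: (@measurable_funS _ _ _ _ setT).
- by apply/disj_setPS => t [] /=; rewrite !in_itv/=; lra.
rewrite EFinD -integral_powR_near0// -integral_powR_infty ?subr_gt0//.
congr (_ + _)%E; apply: eq_integral => t; rewrite inE/= in_itv/=.
- by move=> /andP[t0 t1]; rewrite /abel /heat_decay t0 t1 mulr1.
- rewrite andbT => t1; have t0 : 0 < t by lra.
  rewrite /abel /heat_decay t0 ltNge t1/= -powRD ?(gt_eqF t0) ?implybT//.
  by congr ((_ `^ _)%:E); ring.
Qed.

Lemma heat_op_le f (M I : R) t x : measurable_fun setT f ->
  (forall y, 0 <= f y <= M) -> (\int[lam]_y (f y)%:E <= I%:E)%E -> 0 < t ->
  (heat_op f t x <= ((M + (2 * pi) `^ (- (d%:R / 2)) * I) * heat_decay t)%:E)%E.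
Proof.
move=> mf fM fI t0.
have M0 : 0 <= M by have /andP[] := fM x; exact: le_trans.
have f0 y : 0 <= f y by have /andP[] := fM y.
have I0 : 0 <= I.
  rewrite -lee_fin; apply: le_trans fI.
  by apply: integral_ge0 => y _; rewrite lee_fin.
have mfh : measurable_fun setT (fun y => f y * heat t (x - y)).
  by apply: measurable_funM => //; apply: measurable_heat => //; exact: measurable_cst.
have mh : measurable_fun setT (fun y => heat t (x - y)).
  by apply: measurable_heat => //; exact: measurable_cst.
have b1 : (heat_op f t x <= M%:E)%E.
  rewrite -[leRHS]mule1 -(integral_heat x t0) -ge0_integralZl//.
  - apply: ge0_le_integral => //.
    + by move=> y _; rewrite lee_fin mulr_ge0 ?heat_ge0.
    + exact/measurable_EFinP.
    + by apply/measurable_EFinP; apply: measurable_funM.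
    + move=> y _; rewrite -EFinM lee_fin ler_wpM2r ?heat_ge0//.
      by have /andP[] := fM y.
  - exact/measurable_EFinP.
  - by move=> y _; rewrite lee_fin heat_ge0.
have b2 : (heat_op f t x <= ((2 * pi * t) `^ (- (d%:R / 2)) * I)%:E)%E.
  apply: (@le_trans _ _ (((2 * pi * t) `^ (- (d%:R / 2)))%:E * \int[lam]_y (f
    y)%:E)%E); last first.
    by rewrite EFinM; apply: lee_wpmul2l => //; rewrite lee_fin powR_ge0.
  rewrite -ge0_integralZl//.
  - apply: ge0_le_integral => //.
    + by move=> y _; rewrite lee_fin mulr_ge0 ?heat_ge0.
    + exact/measurable_EFinP.
    + by apply/measurable_EFinP; apply: measurable_funM.
    + by move=> y _; rewrite -EFinM lee_fin mulrC ler_wpM2r// heat_le.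
  - exact/measurable_EFinP.
  - by move=> y _; rewrite lee_fin.
  - by rewrite lee_fin powR_ge0.
rewrite /heat_decay; case: ltP => t1.
  by apply: le_trans b1 _; rewrite lee_fin mulr1 lerDl mulr_ge0// powR_ge0.
apply: le_trans b2 _; rewrite lee_fin powRM//; last 2 first.
- by rewrite mulr_ge0 ?pi_ge0.
- exact: ltW.
by rewrite mulrAC; apply: ler_wpM2r; rewrite ?powR_ge0// lerDr.
Qed.

Lemma riesz_pot_le g f (M I D : R) x : measurable_fun setT f ->
  (forall y, 0 <= f y <= M) -> (\int[lam]_y (f y)%:E <= I%:E)%E ->
  (\int[mu]_t (abel g t * heat_decay t)%R%:E = D%:E)%E ->
  (riesz_pot g f x <= ((M + (2 * pi) `^ (- (d%:R / 2)) * I) * D)%:E)%E.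
Proof.
move=> mf fM fI HD.
have f0 y : 0 <= f y by have /andP[] := fM y.
have M0 : 0 <= M by have /andP[] := fM x; exact: le_trans.
have I0 : 0 <= I.
  rewrite -lee_fin; apply: le_trans fI.
  by apply: integral_ge0 => y _; rewrite lee_fin.
have B0 : 0 <= M + (2 * pi) `^ (- (d%:R / 2)) * I.
  by rewrite addr_ge0// mulr_ge0// powR_ge0.
have m0 : measurable_fun setT (fun t => (abel g t * heat_decay t)%R%:E).
  apply/measurable_EFinP; apply: measurable_funM; last exact: measurable_heat_decay.
  exact: measurable_abel.
have p0 t : (0 <= (abel g t * heat_decay t)%R%:E)%E.
  by rewrite lee_fin; apply: mulr_ge0; [exact: abel_ge0|exact: heat_decay_ge0].
rewrite EFinM -HD -ge0_integralZl//.
apply: ge0_le_integral => //.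
- move=> t _; apply: mule_ge0; last exact: heat_op_ge0.
  by rewrite lee_fin; exact: abel_ge0.
- apply: measurable_EFin_mul; first exact: measurable_abel.
  by apply: measurable_heat_op => //; exact: measurable_cst.
- exact: measurable_EFin_mul.
- move=> t _; rewrite /abel; case: ifPn => t0; last by rewrite mul0r mul0e mule0.
  rewrite -EFinM mulrCA EFinM; apply: lee_wpmul2l; first by rewrite lee_fin powR_ge0.
  exact: heat_op_le.
Qed.

(** Integration of the hypothesis against the heat kernel at x0: the quadratic
    term contributes a multiple of t only, by [sqnorm_heat_le]. *)
Lemma heat_op_separation (f1 f2 : 'rV[R]_d -> R) (eta L : R) x0 :
  measurable_fun setT f1 -> measurable_fun setT f2 ->
  (forall y, 0 <= f1 y) -> (forall y, 0 <= f2 y) -> 0 < eta -> 0 <= L ->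
  (forall y, f1 y + 2 * eta <= f2 y + L * sqnorm (x0 - y)) ->
  exists2 delta : R, 0 < delta & forall t, 0 < t < delta ->
    (heat_op f1 t x0 + eta%:E <= heat_op f2 t x0)%E.
Proof.
move=> mf1 mf2 f10 f20 e0 L0 H.
pose c := L * (4 * 2 `^ (d%:R / 2)).
have c0 : 0 <= c by rewrite !mulr_ge0 ?powR_ge0.
(* c * t is the contribution of the quadratic term, so c * delta <= eta is
   needed; the summand 1 covers c = 0. *)
exists (eta / (c + 1)); first by rewrite divr_gt0// ltr_wpDl.
move=> t /andP[t0 td].
have mh t' : measurable_fun setT (fun y => heat t' (x0 - y)).
  by apply: measurable_heat => //; exact: measurable_cst.
have mq : measurable_fun setT (fun y => sqnorm (x0 - y)).
  by apply: measurable_sqnorm => //; exact: measurable_cst.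
have heat_op_cst k t' : 0 < t' -> 0 <= k -> (\int[lam]_y (k * heat t' (x0 - y))%R%:E
  = k%:E)%E.
  move=> t'0 k0; under eq_integral do rewrite EFinM.
  rewrite ge0_integralZl//.
  - by rewrite integral_heat// mule1.
  - exact/measurable_EFinP.
  - by move=> y _; rewrite lee_fin heat_ge0.
have key : (heat_op f1 t x0 + (2 * eta)%:E <= heat_op f2 t x0 + eta%:E)%E.
  have ct : 0 <= c * t by rewrite mulr_ge0// ltW.
  apply: (@le_trans _ _ (heat_op f2 t x0 + (c * t)%:E)%E); last first.
    apply: leeD => //; rewrite lee_fin; move: td; rewrite ltr_pdivlMr ?ltr_wpDl// =>
      td; nra.
  rewrite -(heat_op_cst (2 * eta) t)//; last by rewrite mulr_ge0// ltW.
  rewrite -(heat_op_cst (c * t) (2 * t))//; last by rewrite mulr_gt0.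
  rewrite /heat_op -!ge0_integralD//=.
  - apply: ge0_le_integral => //.
    + by move=> y _; rewrite -EFinD lee_fin addr_ge0// mulr_ge0 ?heat_ge0// mulr_ge0 ?ltW.
    + by apply/measurable_EFinP; apply: measurable_funD; apply: measurable_funM.
    + by apply/measurable_EFinP; apply: measurable_funD; apply: measurable_funM.
    + move=> y _; rewrite -!EFinD lee_fin -mulrDl.
      apply: (@le_trans _ _ ((f2 y + L * sqnorm (x0 - y)) * heat t (x0 - y))).
        by rewrite ler_wpM2r ?heat_ge0.
      rewrite mulrDl lerD2l -mulrA.
      apply: (@le_trans _ _ (L * (4 * t * 2 `^ (d%:R / 2) * heat (2 * t) (x0 - y)))).
        by rewrite ler_wpM2l// sqnorm_heat_le.
      by rewrite le_eqVlt; apply/orP; left; apply/eqP; rewrite /c; ring.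
  - by move=> y _; rewrite lee_fin mulr_ge0 ?heat_ge0.
  - by apply/measurable_EFinP; apply: measurable_funM.
  - by move=> y _; rewrite lee_fin mulr_ge0 ?heat_ge0.
  - by apply/measurable_EFinP; apply: measurable_funM.
  - by move=> y _; rewrite lee_fin mulr_ge0 ?heat_ge0.
  - by apply/measurable_EFinP; apply: measurable_funM.
  - by move=> y _; rewrite lee_fin mulr_ge0 ?heat_ge0// mulr_ge0 ?ltW.
  - by apply/measurable_EFinP; apply: measurable_funM.
by rewrite -(@leeD2rE _ eta%:E)// -addeA -EFinD -mulr2n -mulr_natl.
Qed.

End heat_bounds.

(** * The Riesz potential as an integral operator *)

Section riesz.
Context {R : realType} {d : nat}.
Local Notation mu := (@lebesgue_measure R).
Local Notation lam := (lebesgue_rV R d).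
Implicit Types (s t : R) (x y z : 'rV[R]_d) (f : 'rV[R]_d -> R).

(** [abel g t * heat t x] as a function of q = |x| ^ 2 and t. *)
Definition riesz_density g q t : R :=
  abel g t * ((2 * pi * t) `^ (- (d%:R / 2)) * expR (- q / (2 * t))).

Lemma riesz_density_ge0 g q t : 0 <= riesz_density g q t.
Proof. by rewrite /riesz_density mulr_ge0 ?abel_ge0// mulr_ge0 ?powR_ge0 ?expR_ge0. Qed.

Lemma measurable_riesz_density g q : measurable_fun setT (riesz_density g q).
Proof.
apply: measurable_funM; first exact: measurable_abel.
apply: measurable_funM.
  by apply: (measurableT_comp (@measurable_powR R _)); exact: measurable_funM.
apply: measurableT_comp => //; apply: measurable_funM => //.
by apply: measurable_invr; exact: measurable_funM.
Qed.

Lemma riesz_density_scale g q t : 0 < q ->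
  riesz_density g q (q * t) = q `^ (g - 1 - d%:R / 2) * riesz_density g 1 t.
Proof.
move=> q0; rewrite /riesz_density /abel pmulr_rgt0//; case: ifPn => t0;
  last by rewrite !mul0r mulr0.
rewrite (@powRM _ q t) ?ltW//.
have -> : 2 * pi * (q * t) = q * (2 * pi * t) by ring.
rewrite (@powRM _ q (2 * pi * t)) ?ltW ?mulr_gt0 ?pi_gt0//.
rewrite (@powRD _ q (g - 1)) ?(gt_eqF q0) ?implybT//.
have -> : - q / (2 * (q * t)) = - 1 / (2 * t) by field; rewrite !gt_eqF.
by ring.
Qed.

(** Hence the potential kernel is a power of |x|: the substitution t = q t'
    reduces to q = 1. *)
Lemma integral_riesz_density_scale g q : 0 < q ->
  (\int[mu]_t (riesz_density g q t)%:E =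
   (q `^ (g - d%:R / 2))%:E * \int[mu]_t (riesz_density g 1 t)%:E)%E.
Proof.
move=> q0; rewrite (@ge0_integral_affine R (fun t => (riesz_density g q t)%:E) q 0
  q0); last 2 first.
- by apply/measurable_EFinP; exact: measurable_riesz_density.
- by move=> t; rewrite lee_fin riesz_density_ge0.
under eq_integral do rewrite addr0 riesz_density_scale// EFinM.
rewrite ge0_integralZl//.
- rewrite muleA -EFinM; congr (_%:E * _)%E.
  by rewrite -{1}(powRr1 (ltW q0)) -powRD ?(gt_eqF q0) ?implybT//; congr (_ `^ _); ring.
- by apply/measurable_EFinP; exact: measurable_riesz_density.
- by move=> t _; rewrite lee_fin riesz_density_ge0.
- by rewrite lee_fin powR_ge0.
Qed.

(** For t < 1, the factor expR (- 1 / (2 t)) <= d! (2 t) ^ d outweighs the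
    singularity t ^ (- d / 2) of the heat kernel. *)
Lemma riesz_density1_le g t : (0 < d)%N ->
  riesz_density g 1 t <= (2 * pi) `^ (- (d%:R / 2)) * (d`!%:R * 2 ^+ d) * (abel g t *
    heat_decay (d:=d) t).
Proof.
move=> d0; rewrite /riesz_density.
have [t0|t0] := leP t 0; first by rewrite /abel ltNge t0/= !mul0r mulr0.
rewrite [leRHS]mulrCA; apply: ler_wpM2l; first exact: abel_ge0.
rewrite powRM ?mulr_ge0 ?pi_ge0 ?(ltW t0)// -!mulrA; apply: ler_wpM2l;
  first exact: powR_ge0.
have f1 : 1 <= d`!%:R * 2 ^+ d :> R.
  by rewrite -natrX -natrM ler1n muln_gt0 fact_gt0 expn_gt0.
have e1 : expR (- 1 / (2 * t)) <= 1.
  by rewrite -expR0 ler_expR mulNr oppr_le0 divr_ge0// mulr_ge0// ltW.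
rewrite /heat_decay; case: ltP => t1; last first.
  by rewrite mulrC mulrA; apply: ler_wpM2r; [exact: powR_ge0|exact: le_trans f1].
have x0 : 0 <= (2 * t)^-1 by rewrite invr_ge0 mulr_ge0// ltW.
have := expR_ge1Dxn d.-1 x0; rewrite prednK// => He.
have {}He : expR (- 1 / (2 * t)) <= d`!%:R * 2 ^+ d * t ^+ d.
  rewrite mulNr mul1r expRN -[leRHS]invrK lef_pV2 ?posrE ?expR_gt0//; last first.
    by rewrite invr_gt0 !mulr_gt0 ?exprn_gt0// ltr0n fact_gt0.
  apply: (@le_trans _ _ ((2 * t)^-1 ^+ d / d`!%:R)); last by lra.
  by rewrite exprVn exprMn -mulrA invfM mulrC.
apply: (@le_trans _ _ (t `^ (- (d%:R / 2)) * (d`!%:R * 2 ^+ d * t ^+ d))).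
  by apply: ler_wpM2l; first exact: powR_ge0.
rewrite mulr1 mulrCA -[leRHS]mulr1 ler_wpM2l ?(le_trans ler01)//.
have -> : t `^ (- (d%:R / 2)) * t ^+ d = t `^ (d%:R / 2).
  rewrite -(@powR_mulrn _ t d (ltW t0)) -powRD; last by rewrite (gt_eqF t0) implybT.
  by congr (_ `^ _); field.
rewrite -[leRHS](powRr0 t); apply: ger_powR; first by rewrite t0 ltW.
by rewrite divr_ge0.
Qed.

Lemma integral_riesz_density1 (g D : R) : (0 < d)%N -> 0 < g <= 1 ->
  (\int[mu]_t (abel g t * heat_decay (d:=d) t)%R%:E = D%:E)%E ->
  exists2 C : R, 0 < C & (\int[mu]_t (riesz_density g 1 t)%:E = C%:E)%E.
Proof.
move=> d0 /andP[g0 g1] HD.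
pose B : R := (2 * pi) `^ (- (d%:R / 2)) * (d`!%:R * 2 ^+ d).
have B0 : 0 <= B by rewrite mulr_ge0 ?powR_ge0// mulr_ge0// exprn_ge0.
have h0 t : (0 <= (riesz_density g 1 t)%:E)%E by rewrite lee_fin riesz_density_ge0.
have mh : measurable_fun setT (fun t => (riesz_density g 1 t)%:E).
  by apply/measurable_EFinP; exact: measurable_riesz_density.
have mkd : measurable_fun setT (fun t => (abel g t * heat_decay (d:=d) t)%:E).
  apply/measurable_EFinP; apply: measurable_funM; last exact: measurable_heat_decay.
  exact: measurable_abel.
have kd0 t : (0 <= (abel g t * heat_decay (d:=d) t)%:E)%E.
  by rewrite lee_fin mulr_ge0 ?abel_ge0 ?heat_decay_ge0.
have fin : (\int[mu]_t (riesz_density g 1 t)%:E <= B%:E * D%:E)%E.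
  rewrite -HD -ge0_integralZl//.
  apply: ge0_le_integral => //.
  - apply/measurable_EFinP; apply: measurable_funM => //; exact/measurable_EFinP.
  - by move=> t _; rewrite -EFinM lee_fin riesz_density1_le.
pose c : R := 2^-1 * ((4 * pi) `^ (- (d%:R / 2)) * expR (- 1)).
have c0 : 0 < c by rewrite !mulr_gt0 ?expR_gt0 ?powR_gt0 ?mulr_gt0 ?pi_gt0 ?invr_gt0.
have pos : (c%:E <= \int[mu]_t (riesz_density g 1 t)%:E)%E.
  apply: (@le_trans _ _ (\int[mu]_(t in `[1%R, 2%R]) (cst c%:E t))%E).
    rewrite integral_cst//= lebesgue_measure_itv/= lte_fin ltr1n.
    by rewrite -EFinB -EFinM lee_fin; lra.
  apply: (@le_trans _ _ (\int[mu]_(t in `[1%R, 2%R]) (riesz_density g 1 t)%:E)%E);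
    last first.
    by apply: ge0_subset_integral.
  apply: ge0_le_integral => //.
  - by move=> t _; rewrite lee_fin ltW.
  - by apply: (@measurable_funS _ _ _ _ setT).
  - move=> t; rewrite /= in_itv/= => /andP[t1 t2].
    have t0 : 0 < t by lra.
    have p4 : 0 < 2 * pi * t :> R by rewrite !mulr_gt0 ?pi_gt0.
    rewrite lee_fin /c /riesz_density /abel t0; apply: ler_pM => //.
    + by rewrite mulr_ge0 ?powR_ge0 ?expR_ge0.
    + apply: (@le_trans _ _ (t `^ (- 1))); last by apply: ler_powR => //; lra.
      rewrite powR_inv1; last exact: ltW.
      by rewrite lef_pV2 ?posrE.
    + apply: ler_pM; rewrite ?powR_ge0 ?expR_ge0//.
      * rewrite !powRN lef_pV2 ?posrE ?powR_gt0 ?mulr_gt0 ?pi_gt0//.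
        apply: ge0_ler_powR; rewrite ?nnegrE ?divr_ge0 ?(ltW p4) ?mulr_ge0 ?pi_ge0//.
        have := pi_gt0 R; nra.
      * by rewrite ler_expR mulNr lerN2 ler_pdivrMr ?mulr_gt0// ; lra.
have fn : (\int[mu]_t (riesz_density g 1 t)%:E)%E \is a fin_num.
  by rewrite ge0_fin_numE ?integral_ge0//; apply: le_lt_trans fin _; rewrite -EFinM ltry.
exists (fine (\int[mu]_t (riesz_density g 1 t)%:E)%E); last by rewrite fineK.
by rewrite -lte_fin fineK//; apply: lt_le_trans pos; rewrite lte_fin.
Qed.

Lemma rV_set1_box x :
  [set x] = [set y : 'rV[R]_d | forall i, [set x ord0 i] (y ord0 i)].
Proof.
apply/seteqP; split=> y /=; first by move=> ->.
by move=> H; apply/rowP => i; rewrite -[RHS]H.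
Qed.

Lemma lebesgue_rV_set1 x : (0 < d)%N -> lam [set x] = 0%E.
Proof.
move=> d0; rewrite rV_set1_box.
rewrite (@lebesgue_rV_prod R d (fun i => [set x ord0 i])); last first.
  by move=> i; exact: measurable_set1.
under eq_bigr do rewrite lebesgue_measure_set1.
by rewrite (bigD1 (Ordinal d0))//= mul0e.
Qed.

(** Tonelli's theorem and [integral_riesz_density_scale]. The inner integral
    diverges for y = x, where the right-hand side has a 0; this is a null
    set. *)
Lemma riesz_potE g f x C : (0 < d)%N -> 0 < g -> measurable_fun setT f ->
  (forall y, 0 <= f y) ->
  g - d%:R / 2 != 0 ->
  (\int[mu]_t (riesz_density g 1 t)%:E = C%:E)%E ->
  (riesz_pot g f x = \int[lam]_y (f y * (C * sqnorm (x - y) `^ (g - d%:R / 2)))%R%:E)%E.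
Proof.
move=> d0 g0 mf f0 gd HC.
have C0 : 0 <= C.
  by rewrite -lee_fin -HC integral_ge0// => t _; rewrite lee_fin riesz_density_ge0.
have mq : measurable_fun setT (fun y => sqnorm (x - y)).
  by apply: measurable_sqnorm => //; exact: measurable_cst.
rewrite /riesz_pot.
transitivity (\int[mu]_t \int[lam]_y ((f y * riesz_density g (sqnorm (x - y)) t)%R%:E))%E.
  apply: eq_integral => t _; rewrite -ge0_integralZl//.
  - by apply: eq_integral => y _; rewrite -EFinM mulrCA.
  - apply/measurable_EFinP; apply: measurable_funM => //.
    by apply: measurable_heat => //; exact: measurable_cst.
  - by move=> y _; rewrite lee_fin mulr_ge0 ?heat_ge0.
  - by rewrite lee_fin abel_ge0.
rewrite (@fubini_tonelli _ _ _ _ _ mu lam (fun p : R * 'rV[R]_d =>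
    ((f p.2 * riesz_density g (sqnorm (x - p.2)) p.1)%R%:E)))/=; last 2 first.
- apply/measurable_EFinP; apply: measurable_funM.
    exact: (measurableT_comp mf measurable_snd).
  apply: measurable_funM.
    exact: (measurableT_comp (measurable_abel g) measurable_fst).
  by apply: measurable_heat; [exact: measurable_fst|exact: measurable_cst|exact:
    measurable_snd].
- by move=> p; rewrite lee_fin mulr_ge0 ?riesz_density_ge0.
have mE y : (\int[mu]_t (f y * riesz_density g (sqnorm (x - y)) t)%R%:E =
    (f y)%:E * \int[mu]_t (riesz_density g (sqnorm (x - y)) t)%:E)%E.
  rewrite -ge0_integralZl//.
  - by apply/measurable_EFinP; exact: measurable_riesz_density.
  - by move=> t _; rewrite lee_fin riesz_density_ge0.
  - by rewrite lee_fin.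
apply: ge0_ae_eq_integral => //.
- apply: (@measurable_fun_fubini_tonelli_F _ _ _ _ _ mu
    (fun p : 'rV[R]_d * R => (f p.1 * riesz_density g (sqnorm (x - p.1)) p.2)%R%:E)).
  + apply/measurable_EFinP; apply: measurable_funM.
      exact: (measurableT_comp mf measurable_fst).
    apply: measurable_funM.
      exact: (measurableT_comp (measurable_abel g) measurable_snd).
    by apply: measurable_heat; [exact: measurable_snd|exact: measurable_cst|exact:
      measurable_fst].
  + by move=> p; rewrite lee_fin mulr_ge0 ?riesz_density_ge0.
- apply/measurable_EFinP; apply: measurable_funM => //; apply: measurable_funM => //.
  by apply: (measurableT_comp (@measurable_powR R _)).
- by move=> y _; rewrite integral_ge0// => t _; rewrite lee_fin mulr_ge0
    ?riesz_density_ge0.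
- by move=> y _; rewrite lee_fin mulr_ge0// mulr_ge0 ?powR_ge0.
- exists [set x]; split.
  + rewrite rV_set1_box.
    apply: (@measurable_rV_box R d (fun i => [set x ord0 i])) => i.
    exact: measurable_set1.
  + exact: lebesgue_rV_set1.
  + move=> y /= Hy; apply: contrapT => yx; apply: Hy => _.
    rewrite mE integral_riesz_density_scale; last first.
      rewrite lt_neqAle sqnorm_ge0 andbT eq_sym; apply/negP => /eqP H.
      apply: yx; apply/rowP => i; apply/eqP; rewrite eq_sym -subr_eq0.
      move/eqP : H; rewrite psumr_eq0; last by move=> j _; exact: sqr_ge0.
      by move=> /allP/(_ i (mem_index_enum _)); rewrite /= !mxE sqrf_eq0.
    by rewrite HC -!EFinM [C * _]mulrC.
Qed.

(** At x = y the two sides agree too: a negative power of 0 is 0. *)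
Lemma green_powE (beta : R) x y : (3 <= d)%N -> 1 <= beta ->
  green x y `^ beta = green_const R d `^ beta *
    sqnorm (x - y) `^ (d%:R / 2 - beta * (d%:R - 2) / 2 - d%:R / 2).
Proof.
move=> d3 b1; rewrite /green powRM ?powR_ge0//; last first.
  rewrite /green_const divr_ge0 ?mulr_ge0 ?powR_ge0//.
  by apply: Rintegral_ge0 => t _; rewrite mulr_ge0 ?powR_ge0 ?expR_ge0.
congr (_ * _); rewrite /euclidean_norm -/(sqnorm (x - y)) -powR12_sqrt ?sqnorm_ge0//.
by rewrite -!powRrM; congr (_ `^ _); field.
Qed.

End riesz.

(** * Topology and measurability in coordinates *)

Section topology.
Context {R : realType} {d : nat}.
Local Notation mu := (@lebesgue_measure R).
Local Notation lam := (lebesgue_rV R d).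
Implicit Types (s t : R) (x y z : 'rV[R]_d) (f F : 'rV[R]_d -> R).

Lemma norm_coord_le x i : `|x ord0 i| <= `|x|.
Proof.
rewrite -[`|x|]/(mx_norm x) mx_normrE.
by apply: (le_bigmax _ (fun ij : 'I_1 * 'I_d => `|x ij.1 ij.2|) (ord0, i)).
Qed.

(** The norm on the left is the sup norm. *)
Lemma sqr_norm_le_sqnorm x : `|x| ^+ 2 <= sqnorm x.
Proof.
have [->|x0] := eqVneq x 0; first by rewrite normr0 expr0n/= sqnorm_ge0.
have /mx_norm_neq0[[i j] /= H] : mx_norm x != 0 by rewrite -[mx_norm x]/`|x| normr_eq0.
rewrite -[`|x|]/(mx_norm x) H ord1 real_normK ?num_real//.
rewrite /sqnorm (bigD1 j)//= lerDl.
by apply: sumr_ge0 => k _; exact: sqr_ge0.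
Qed.

Lemma measurable_rV_ball x (e : R) : 0 < e -> measurable (ball x e).
Proof.
move=> e0.
rewrite (_ : ball x e = [set y | forall i, ball (x ord0 i) e (y ord0 i)]).
  apply: (@measurable_rV_box R d (fun i => ball (x ord0 i) e)) => i.
  exact: measurable_ball.
apply/seteqP; split=> y; first by case=> _ xy i; exact: xy.
by move=> H; split => // i j; rewrite ord1; exact: H.
Qed.

(** An open set is the union of the balls contained in it that have a rational
    centre and a radius 1 / (n + 1), and these are countably many. *)
Lemma open_measurable_rV (U : set 'rV[R]_d) : open U -> measurable U.
Proof.
move=> oU.
pose e (n : nat) : R := n.+1%:R^-1.
have e0 n : 0 < e n by rewrite invr_gt0.
pose c (q : 'rV[rat]_d) : 'rV[R]_d := map_mx ratr q.
pose B (p : 'rV[rat]_d * nat) := if `[< ball (c p.1) (e p.2) `<=` U >]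
  then ball (c p.1) (e p.2) else set0.
rewrite (_ : U = \bigcup_p B p).
  apply: countable_bigcupT_measurable => //.
  by move=> p; rewrite /B; case: asboolP => _ //; exact: measurable_rV_ball.
apply/seteqP; split=> [x Ux|x [p _]]; last by rewrite /B; case: asboolP => // BU;
  exact: BU.
have /nbhs_ballP[r /= r0 rU] : nbhs x U by exact: open_nbhs_nbhs.
have [n nr] : exists n, e n < r / 2.
  have [n _ Hn] := near_infty_natSinv_lt (PosNum (divr_gt0 r0 (ltr0n _ 2))).
  by exists n; exact: (Hn n (leqnn n)).
have Hq i : exists q : rat, ball (x ord0 i) (e n) (ratr q).
  have xe : x ord0 i - e n < x ord0 i + e n by have := e0 n; lra.
  have [q] := rat_in_itvoo xe; rewrite in_itv /= => qi; exists q.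
  by rewrite /ball/= ltr_norml; lra.
have [q qP] := choice Hq.
exists (\row_i q i, n) => //; rewrite /B.
have cx : ball (c (\row_i q i)) (e n) x.
  apply: ball_sym; split => // i j; rewrite ord1 !mxE; exact: qP.
case: asboolP => //= -[]; move=> y cy; apply: rU.
have := ball_triangle (ball_sym cx) cy.
by apply: le_ball; lra.
Qed.

Lemma continuous_measurable_rV F : continuous F -> measurable_fun setT F.
Proof.
move=> cF; apply: (measurability _ (RGenOpens.measurableE R)).
move=> _ [_ [a [b ->]] <-]; rewrite setTI; apply: open_measurable_rV.
by apply: open_comp => //; exact: interval_open.
Qed.

(** Dominated convergence is about sequences; this brings it to bear on
    continuity. *)
Lemma cvg_sequence_continuous F x :
  (forall X : nat -> 'rV[R]_d, X n @[n --> \oo] --> x -> F (X n) @[n --> \oo] --> F x) ->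
  {for x, continuous F}.
Proof.
move=> H; apply/(@cvgrPdist_lt _ _ _ _ (nbhs_filter x)) => e e0; apply: contrapT => nH.
have Hn (n : nat) : exists y, ball x n.+1%:R^-1 y /\ e <= `|F x - F y|.
  apply: contrapT => /forallNP K; apply: nH.
  apply/nbhs_ballP; exists n.+1%:R^-1 => /=; first by rewrite invr_gt0.
  move=> y xy /=; have := K y => /not_andP[//|/negP]; by rewrite -ltNge.
have [X XP] := choice Hn.
have cX : X n @[n --> \oo] --> x.
  apply/cvg_ballP => r r0.
  have [n _ Hr] := near_infty_natSinv_lt (PosNum r0).
  exists n => // m nm; have [+ _] := XP m; apply: le_ball.
  by apply: ltW; exact: (Hr m nm).
have /cvgrPdist_lt/(_ e e0)[n _ /(_ n (leqnn n))] := H X cX.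
by have [_ +] := XP n => /=; rewrite leNgt => /negP.
Qed.

Lemma cvg_coord (X : nat -> 'rV[R]_d) x i :
  X n @[n --> \oo] --> x -> X n ord0 i @[n --> \oo] --> x ord0 i.
Proof.
move=> cX; apply: (@cvg_comp _ _ _ X (fun M : 'rV[R]_d => M ord0 i) _ (nbhs x) (nbhs
  (x ord0 i)) cX).
exact: coord_continuous.
Qed.

Lemma cvg_heat t (X : nat -> 'rV[R]_d) x y :
  X n @[n --> \oo] --> x -> heat t (X n - y) @[n --> \oo] --> heat t (x - y).
Proof.
move=> cX; apply: cvgM; first exact: cvg_cst.
apply: (@cvg_comp _ _ _ (fun n => - sqnorm (X n - y) / (2 * t)) expR _ (nbhs (-
  sqnorm (x - y) / (2 * t)))); last exact: continuous_expR.
apply: cvgM; last exact: cvg_cst.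
apply: cvgN; rewrite /sqnorm.
elim: (index_enum _) => [|i r IH].
  by under eq_fun do rewrite big_nil; rewrite big_nil; exact: cvg_cst.
rewrite big_cons; under eq_fun do rewrite big_cons.
apply: cvgD => //; rewrite expr2; under eq_fun do rewrite expr2.
have cXi : (X n - y) ord0 i @[n --> \oo] --> (x - y) ord0 i.
  rewrite !mxE; under eq_fun do rewrite !mxE.
  by apply: cvgB; [exact: cvg_coord|exact: cvg_cst].
by apply: cvgM.
Qed.

End topology.

(** * Functions with bounded support and the continuity of their potentials *)

Section box_bounded.
Context {R : realType} {d : nat}.
Local Notation mu := (@lebesgue_measure R).
Local Notation lam := (lebesgue_rV R d).
Implicit Types (s t : R) (x y z : 'rV[R]_d) (f F : 'rV[R]_d -> R).

Definition box_bounded (M N : R) f := [/\ measurable_fun setT f,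
  forall y, 0 <= f y <= M & forall y, f y != 0 -> `|y| <= N].

Lemma integral_box_le M N f : 0 <= N -> box_bounded M N f ->
  (\int[lam]_y (f y)%:E <= (M * (2 * N) ^+ d)%:E)%E.
Proof.
move=> N0 [mf fM fN].
have M0 : 0 <= M by have /andP[] := fM 0; exact: le_trans.
pose A := [set y : 'rV[R]_d | forall i : 'I_d, `[- N, N]%classic (y ord0 i)].
have mA : measurable A.
  by apply: (@measurable_rV_box R d (fun=> `[- N, N]%classic)).
have lA : lam A = ((2 * N) ^+ d)%:E.
  rewrite (@lebesgue_rV_prod R d (fun=> `[- N, N]%classic)) => [|i];
    last exact: measurable_itv.
  rewrite (eq_bigr (fun=> (2 * N)%:E)).
    by rewrite prodEFin prodr_const card_ord.
  move=> i _; rewrite lebesgue_measure_itv/= lte_fin.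
  case: ifPn => NN; first by congr (_%:E); ring.
  by congr (_%:E); lra.
apply: (@le_trans _ _ (\int[lam]_(y in A) (cst M%:E y))%E).
  rewrite [leRHS]integral_mkcond; apply: ge0_le_integral => //.
  - by move=> y _; rewrite lee_fin; have /andP[] := fM y.
  - exact/measurable_EFinP.
  - exact/(measurable_restrictT _ _).1.
  - move=> y _; rewrite patchE; case: ifPn => [_|]; first by rewrite lee_fin;
      have /andP[] := fM y.
    rewrite notin_setE => nA; rewrite lee_fin.
    have [->//|fy] := eqVneq (f y) 0.
    exfalso; apply: nA => i; rewrite /= in_itv/= -ler_norml.
    exact: le_trans (norm_coord_le _ _) (fN _ fy).
by rewrite integral_cst// EFinM; apply: lee_wpmul2l; rewrite ?lee_fin// -lA.
Qed.

Lemma cvg_heat_op M N f t (X : nat -> 'rV[R]_d) x : 0 <= N -> box_bounded M N f ->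
  0 < t ->
  X n @[n --> \oo] --> x -> heat_op f t (X n) @[n --> \oo] --> heat_op f t x.
Proof.
move=> N0 fbox t0 cX; have [mf fM fN] := fbox.
have mh y : measurable_fun setT (fun z => (f z * heat t (y - z))%R%:E).
  apply/measurable_EFinP; apply: measurable_funM => //.
  by apply: measurable_heat => //; exact: measurable_cst.
pose c := (2 * pi * t) `^ (- (d%:R / 2)).
have c0 : 0 <= c by exact: powR_ge0.
have f0 y : 0 <= f y by have /andP[] := fM y.
have [] := @dominated_convergence _ _ _ lam setT measurableT
  (fun n y => (f y * heat t (X n - y))%R%:E) (fun y => (f y * heat t (x - y))%R%:E)
  (fun y => (f y * c)%:E) (fun n => mh _) (mh _).
- apply: aeW => y _; apply: cvg_EFin; first by near=> n.
  by apply: cvgM; [exact: cvg_cst|exact: cvg_heat].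
- apply/integrableP; split.
    by apply/measurable_EFinP; apply: measurable_funM.
  apply: (@le_lt_trans _ _ (\int[lam]_y (c%:E * (f y)%:E))%E).
    under eq_integral do rewrite gee0_abs ?lee_fin ?mulr_ge0// mulrC EFinM.
    exact: lexx.
  rewrite ge0_integralZl//.
  + apply: lte_mul_pinfty; rewrite ?lee_fin//.
    by apply: le_lt_trans (integral_box_le N0 fbox) _; rewrite ltry.
  + exact/measurable_EFinP.
  + by move=> y _; rewrite lee_fin.
- apply: aeW => y n _; rewrite gee0_abs ?lee_fin ?mulr_ge0 ?heat_ge0//.
  by rewrite ler_wpM2l// heat_le.
by move=> _ _ /=.
Unshelve. all: by end_near. Qed.

(** Dominated convergence in t on top of [cvg_heat_op]: the kernel of the
    potential is unbounded, but by [heat_op_le] the functions of t are dominated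
    by a multiple of [abel g t * heat_decay t], whatever the point. *)
Lemma cvg_riesz_pot g M N f D (X : nat -> 'rV[R]_d) x : 0 <= N -> box_bounded M N f ->
  (\int[mu]_t (abel g t * heat_decay (d:=d) t)%R%:E = D%:E)%E ->
  X n @[n --> \oo] --> x -> riesz_pot g f (X n) @[n --> \oo] --> riesz_pot g f x.
Proof.
move=> N0 fbox HD cX; have [mf fM fN] := fbox.
have f0 y : 0 <= f y by have /andP[] := fM y.
have M0 : 0 <= M by have /andP[] := fM 0; exact: le_trans.
pose I := M * (2 * N) ^+ d.
have I0 : 0 <= I by rewrite mulr_ge0// exprn_ge0// mulr_ge0.
pose B := M + (2 * pi) `^ (- (d%:R / 2)) * I.
have B0 : 0 <= B by rewrite addr_ge0// mulr_ge0// powR_ge0.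
have mh y : measurable_fun setT (fun t => (abel g t)%:E * heat_op f t y)%E.
  apply: measurable_EFin_mul; first exact: measurable_abel.
  by apply: measurable_heat_op => //; exact: measurable_cst.
have kd0 t : 0 <= abel g t * heat_decay (d:=d) t.
  by rewrite mulr_ge0 ?abel_ge0 ?heat_decay_ge0.
have mkd : measurable_fun setT (fun t => abel g t * heat_decay (d:=d) t).
  by apply: measurable_funM; [exact: measurable_abel|exact: measurable_heat_decay].
have le_dom y t : ((abel g t)%:E * heat_op f t y <= (B * (abel g t * heat_decay
  (d:=d) t))%:E)%E.
  rewrite /abel; case: ifPn => t0; last by rewrite mul0r mul0e mulr0.
  rewrite mulrCA EFinM; apply: lee_wpmul2l; first by rewrite lee_fin powR_ge0.
  by apply: heat_op_le => //; exact: integral_box_le.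
have [] := @dominated_convergence _ _ _ mu setT measurableT
  (fun n t => (abel g t)%:E * heat_op f t (X n))%E (fun t => (abel g t)%:E * heat_op
    f t x)%E
  (fun t => (B * (abel g t * heat_decay (d:=d) t))%:E) (fun n => mh _) (mh _).
- apply: aeW => t _; rewrite /abel; case: ifPn => t0.
    apply: cvgeZl => //; exact: (cvg_heat_op N0 fbox).
  under eq_fun do rewrite mul0e; rewrite mul0e; exact: cvg_cst.
- apply/integrableP; split.
    by apply/measurable_EFinP; apply: measurable_funM.
  have absE t : `|(B * (abel g t * heat_decay (d:=d) t))%:E|%E =
      (B%:E * (abel g t * heat_decay (d:=d) t)%:E)%E.
    by rewrite gee0_abs//= lee_fin; apply: mulr_ge0.
  under eq_integral do rewrite absE.
  rewrite ge0_integralZl//.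
  + by rewrite HD -EFinM ltry.
  + exact/measurable_EFinP.
  + by move=> y _; rewrite lee_fin.
- apply: aeW => t n _; rewrite gee0_abs//.
  by apply: mule_ge0; [rewrite lee_fin; exact: abel_ge0|exact: heat_op_ge0].
by move=> _ _ /=.
Qed.

End box_bounded.

(** * The maximum of a Riesz potential *)

Section maximum.
Context {R : realType} {d : nat}.
Local Notation mu := (@lebesgue_measure R).
Local Notation lam := (lebesgue_rV R d).
Implicit Types (s t : R) (x y z : 'rV[R]_d) (f F : 'rV[R]_d -> R).

Lemma compactly_supported_bounded F : compactly_supported_continuous F ->
  exists M N : R, [/\ 0 <= N, forall y, `|F y| <= M & forall y, F y != 0 -> `|y| <= N].
Proof.
move=> [cF cK]; set K := closure _ in cK.
have FK y : F y != 0 -> K y by move=> Fy; exact: subset_closure.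
have [N [_ HN]] := compact_bounded cK.
have cFK : compact (F @` K).
  by apply: continuous_compact => //; exact: continuous_subspaceT.
have [M [_ HM]] := compact_bounded cFK.
exists (Num.max (M + 1) 0), (Num.max (N + 1) 0); split.
- by rewrite le_max lexx orbT.
- move=> y; have [->|Fy] := eqVneq (F y) 0; first by rewrite normr0 le_max lexx orbT.
  rewrite le_max; apply/orP; left; apply: (HM (M + 1)); first by rewrite ltrDl.
  by exists y => //; exact: FK.
- move=> y Fy; rewrite le_max; apply/orP; left.
  by apply: (HN (N + 1)); [rewrite ltrDl|exact: FK].
Qed.

Lemma box_bounded_funrposneg M N F : continuous F ->
  (forall y, `|F y| <= M) -> (forall y, F y != 0 -> `|y| <= N) ->
  box_bounded M N (F^\+) /\ box_bounded M N (F^\-).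
Proof.
move=> cF FM FN; have mF := continuous_measurable_rV cF.
have H y : - M <= F y <= M by rewrite -ler_norml.
have M0 : 0 <= M by apply: le_trans (FM 0).
split; split.
- exact: measurable_funrpos.
- move=> y; rewrite funrpos_ge0/= /funrpos ge_max M0 andbT.
  by have /andP[] := H y.
- move=> y Hy; apply: FN; apply: contra_neq Hy => Hy.
  by rewrite /funrpos Hy maxxx.
- exact: measurable_funrneg.
- move=> y; rewrite funrneg_ge0/= /funrneg ge_max M0 andbT.
  by have /andP[] := H y; lra.
- move=> y Hy; apply: FN; apply: contra_neq Hy => Hy.
  by rewrite /funrneg Hy oppr0 maxxx.
Qed.

Lemma riesz_pot_fin_num g M N f D x : 0 <= N -> box_bounded M N f ->
  (\int[mu]_t (abel g t * heat_decay (d:=d) t)%R%:E = D%:E)%E ->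
    riesz_pot g f x \is a fin_num.
Proof.
move=> N0 fbox HD; have [mf fM fN] := fbox.
have f0 y : 0 <= f y by have /andP[] := fM y.
rewrite ge0_fin_numE ?riesz_pot_ge0//.
by apply: le_lt_trans (riesz_pot_le x mf fM (integral_box_le N0 fbox) HD) _; rewrite ltry.
Qed.

Lemma fine_subr_le (p q p' q' : \bar R) :
  p \is a fin_num -> q \is a fin_num -> p' \is a fin_num -> q' \is a fin_num ->
  fine p - fine q <= fine p' - fine q' -> (p + q' <= q + p')%E.
Proof.
case: p => [p| |]// _; case: q => [q| |]// _; case: p' => [p'| |]// _.
by case: q' => [q'| |]// _ /= H; rewrite -!EFinD lee_fin; lra.
Qed.

(** The maximum inequality, averaged against the heat kernel at x0, is the integral
    inequality refuted by [no_separation_lt1] and [no_separation_eq1] when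
    P_t (F^\-) x0 exceeds P_t (F^\+) x0 for small t; and it does if F x0 < 0. *)
Lemma no_negative_maximum g D F x0 : 0 < g <= 1 ->
  (\int[mu]_t (abel g t * heat_decay (d:=d) t)%R%:E = D%:E)%E ->
  compactly_supported_continuous F ->
  (forall x, fine (riesz_pot g F^\+ x) - fine (riesz_pot g F^\- x) <=
             fine (riesz_pot g F^\+ x0) - fine (riesz_pot g F^\- x0)) ->
  0 <= F x0.
Proof.
move=> /andP[g0 g1] HD CF Hmax; rewrite leNgt; apply/negP => Fx0.
have [M [N [N0 FM FN]]] := compactly_supported_bounded CF.
have [cF _] := CF.
have [bp bn] := box_bounded_funrposneg cF FM FN.
have [mp _ _] := bp; have [mn _ _] := bn.
have p0 := funrpos_ge0 F; have n0 := funrneg_ge0 F.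
have fp x := riesz_pot_fin_num x N0 bp HD; have fn x := riesz_pot_fin_num x N0 bn HD.
pose eta : R := - F x0 / 4.
have e0 : 0 < eta by rewrite divr_gt0// oppr_gt0.
(* That is, F <= - 2 * eta + L * sqnorm (x0 - .): near x0 by continuity, and at
   distance at least r because F <= M. *)
have [L [L0 HL]] : exists L, 0 <= L /\ forall y, F^\+ y + 2 * eta <= F^\- y + L *
  sqnorm (x0 - y).
  have /cvgrPdist_lt/(_ (2 * eta)) := cF x0.
  move=> /(_ (mulr_gt0 (ltr0n _ 2) e0)) /nbhs_ballP[r /= r0 Hr].
  have M0 : 0 <= M by apply: le_trans (FM 0).
  have c0 : 0 <= (M + 2 * eta) / r ^+ 2 by apply: divr_ge0; [lra|exact: sqr_ge0].
  exists ((M + 2 * eta) / r ^+ 2); split => //.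
  move=> y; have FE : F y = F^\+ y - F^\- y by rewrite -{1}(funrposBneg F).
  have Ly : 0 <= (M + 2 * eta) / r ^+ 2 * sqnorm (x0 - y).
    by rewrite mulr_ge0 ?sqnorm_ge0.
  have [xy|xy] := ltP `|x0 - y| r.
    have : ball x0 r y by rewrite mx_norm_ball /ball_.
    by move=> /Hr; rewrite /= ltr_norml /eta => /andP[]; rewrite /eta in Ly *; lra.
  have : M + 2 * eta <= (M + 2 * eta) / r ^+ 2 * sqnorm (x0 - y).
    rewrite mulrAC ler_pdivlMr ?exprn_gt0//; apply: ler_wpM2l; first lra.
    apply: le_trans (sqr_norm_le_sqnorm _).
    by rewrite ler_pXn2r ?nnegrE// ltW.
  have := FM y; rewrite ler_norml; lra.
have [delta d0 near0] := heat_op_separation mp mn p0 n0 e0 L0 HL.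
have mh (f : 'rV[R]_d -> R) : measurable_fun setT f -> (forall y, 0 <= f y) ->
    measurable_fun setT (fun t => heat_op f t x0).
  by move=> mf f0; apply: measurable_heat_op => //; exact: measurable_cst.
have Hs s : 0 < s -> (\int[mu]_t ((abel g (t - s)%R)%:E * heat_op F^\+%R t x0) +
    \int[mu]_t ((abel g t)%:E * heat_op F^\-%R t x0) <=
    \int[mu]_t ((abel g t)%:E * heat_op F^\+%R t x0) +
    \int[mu]_t ((abel g (t - s)%R)%:E * heat_op F^\-%R t x0))%E.
  move=> s0; rewrite -(heat_riesz_pot g x0 mp p0 s0) -(heat_riesz_pot g x0 mn n0 s0).
  change ((\int[lam]_x ((heat s (x0 - x)%R)%:E * riesz_pot g F^\+%R x) + riesz_pot g
    F^\-%R x0 <=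
    riesz_pot g F^\+%R x0 + \int[lam]_x ((heat s (x0 - x)%R)%:E * riesz_pot g F^\-%R
      x))%E).
  have hs0 x : (0 <= (heat s (x0 - x))%:E)%E by rewrite lee_fin heat_ge0.
  have mhs : measurable_fun setT (fun x => heat s (x0 - x)).
    by apply: measurable_heat => //; exact: measurable_cst.
  have avg f c : measurable_fun setT f -> (forall y, 0 <= f y) -> (0 <= c)%E ->
      (\int[lam]_x ((heat s (x0 - x)%R)%:E * (riesz_pot g f x + c)) =
       \int[lam]_x ((heat s (x0 - x)%R)%:E * riesz_pot g f x) + c)%E.
    move=> mf f0 c0; rewrite -{2}(mul1e c) -(integral_heat x0 s0) -ge0_integralZr//;
      last exact/measurable_EFinP.
    rewrite -ge0_integralD//.
    - by apply: eq_integral => x _; rewrite ge0_muleDr// riesz_pot_ge0.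
    - by move=> x _; rewrite mule_ge0// riesz_pot_ge0.
    - by apply: measurable_EFin_mul => //; exact: measurable_riesz_pot.
    - by move=> x _; rewrite mule_ge0.
    - by apply: measurable_EFin_mul => //; exact: measurable_cst.
  have leeq (u v w r : \bar R) : u = v -> w = r -> (u <= w)%E ->
    (v <= r)%E by move=> -> ->.
  have E1 := avg _ _ mp p0 (riesz_pot_ge0 g x0 n0).
  have E2 := etrans (avg _ _ mn n0 (riesz_pot_ge0 g x0 p0)) (addeC _ _).
  refine (leeq _ _ _ _ E1 E2 _).
  apply: ge0_le_integral.
  - exact: measurableT.
  - move=> x _; apply: mule_ge0; first exact: hs0.
    by apply: adde_ge0; exact: riesz_pot_ge0.
  - apply: measurable_EFin_mul; first exact: mhs.
    apply: emeasurable_funD; last exact: measurable_cst.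
    exact: measurable_riesz_pot.
  - apply: measurable_EFin_mul; first exact: mhs.
    apply: emeasurable_funD; last exact: measurable_cst.
    exact: measurable_riesz_pot.
  - move=> x _; apply: lee_wpmul2l; first exact: hs0.
    exact: fine_subr_le (fp x) (fn x) (fp x0) (fn x0) (Hmax x).
have lty f : riesz_pot g f x0 \is a fin_num -> (forall y, 0 <= f y) ->
  (riesz_pot g f x0 < +oo)%E.
  by move=> ff f0; rewrite -ge0_fin_numE// riesz_pot_ge0.
have ha t : (0 <= heat_op F^\+%R t x0)%E by exact: heat_op_ge0.
have hb t : (0 <= heat_op F^\-%R t x0)%E by exact: heat_op_ge0.
move: g1; rewrite le_eqVlt => /orP[/eqP g1|g1].
- rewrite g1 in fp fn Hs lty *.
  exact: (no_separation_eq1 d0 e0 (mh _ mp p0) (mh _ mn n0) ha hb (lty _ (fp x0) p0)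
    (lty _ (fn x0) n0) near0 Hs).
- have g01 : 0 < g < 1 by rewrite g0.
  exact: (no_separation_lt1 g01 d0 e0 (mh _ mp p0) (mh _ mn n0) ha hb (lty _ (fp x0)
    p0) (lty _ (fn x0) n0) near0 Hs).
Qed.

End maximum.

(** * The operator with the power of the Green kernel as kernel *)

Section green.
Context {R : realType} {d : nat}.
Context (beta : R).
Context (d3 : (3 <= d)%N) (beta1 : 1 <= beta).
Context (betad : beta < d%:R / (d%:R - 2)).
Local Notation mu := (@lebesgue_measure R).
Local Notation lam := (lebesgue_rV R d).
Implicit Types (s t : R) (x y z : 'rV[R]_d) (f F : 'rV[R]_d -> R).

(** With this order 2 g - d = beta (2 - d). The bounds on beta are equivalent to
    0 < g <= 1. *)
Let g : R := d%:R / 2 - beta * (d%:R - 2) / 2.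

Let d3R : 3 <= d%:R :> R.
Proof. by rewrite ler_nat. Qed.

Let g01 : 0 < g <= 1.
Proof.
have d2 : 0 < d%:R - 2 :> R by have := d3R; lra.
have := betad; rewrite ltr_pdivlMr// => H.
have : 1 * (d%:R - 2) <= beta * (d%:R - 2) by rewrite ler_pM2r.
by rewrite /g; lra.
Qed.

Let gd : 0 < g < d%:R / 2.
Proof.
have /andP[g0 g1] := g01; rewrite g0/=.
by apply: le_lt_trans g1 _; have := d3R; lra.
Qed.

Lemma green_riesz_pot : exists2 k : R, 0 <= k & forall f x,
  measurable_fun setT f -> (forall y, 0 <= f y) ->
  (\int[lam]_y (f y * green x y `^ beta)%R%:E = k%:E * riesz_pot g f x)%E.
Proof.
have [D _ HD] := integral_abel_decay gd.
have d0 : (0 < d)%N by apply: leq_trans d3.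
have [C C0 HC] := integral_riesz_density1 d0 g01 HD.
have gnz : g - d%:R / 2 != 0 by have /andP[_ H] := gd; rewrite subr_eq0 lt_eqF.
exists (green_const R d `^ beta / C); first by rewrite divr_ge0 ?powR_ge0// ltW.
move=> f x mf f0; have /andP[g0 _] := g01.
have mq : measurable_fun setT (fun y => sqnorm (x - y)).
  by apply: measurable_sqnorm => //; exact: measurable_cst.
rewrite (riesz_potE x d0 g0 mf f0 gnz HC) -ge0_integralZl//.
- apply: eq_integral => y _; rewrite green_powE// -EFinM; congr (_%:E).
  by rewrite -/g; field; rewrite gt_eqF.
- apply/measurable_EFinP; apply: measurable_funM => //; apply: measurable_funM => //.
  by apply: (measurableT_comp (@measurable_powR R _)).
- by move=> y _; rewrite lee_fin mulr_ge0// mulr_ge0 ?powR_ge0// ltW.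
- by rewrite lee_fin divr_ge0 ?powR_ge0// ltW.
Qed.

Lemma measurable_green_pow x : measurable_fun setT (fun y => green x y `^ beta).
Proof.
under eq_fun do rewrite green_powE//.
apply: measurable_funM => //; apply: (measurableT_comp (@measurable_powR R _)).
by apply: measurable_sqnorm => //; exact: measurable_cst.
Qed.

Lemma integrable_green_pow F x : compactly_supported_continuous F ->
  lam.-integrable setT (EFin \o (fun y => F y * green x y `^ beta)).
Proof.
move=> CF; have [M [N [N0 FM FN]]] := compactly_supported_bounded CF; have [cF _] := CF.
have mF := continuous_measurable_rV cF.
have fbox : box_bounded M N (fun y => `|F y|).
  split.
  - exact: measurableT_comp.
  - by move=> y; rewrite normr_ge0 FM.
  - by move=> y; rewrite normr_eq0; exact: FN.
apply/integrableP; split.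
  by apply/measurable_EFinP; apply: measurable_funM => //; exact: measurable_green_pow.
have [D _ HD] := integral_abel_decay gd.
have [k k0 Hk] := green_riesz_pot.
under eq_integral do rewrite /= normrM (ger0_norm (powR_ge0 _ _)).
rewrite Hk//; last exact: measurableT_comp.
apply: lte_mul_pinfty; rewrite ?lee_fin//.
have ff := riesz_pot_fin_num x N0 fbox HD.
by rewrite -ge0_fin_numE// riesz_pot_ge0.
Qed.

Lemma green_op_riesz_pot : exists2 k : R, 0 <= k & forall F,
  compactly_supported_continuous F -> forall x,
  green_op beta F x = k * (fine (riesz_pot g F^\+ x) - fine (riesz_pot g F^\- x)).
Proof.
have [k k0 Hk] := green_riesz_pot; exists k => // F CF x.
have [M [N [N0 FM FN]]] := compactly_supported_bounded CF; have [cF _] := CF.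
have [bp bn] := box_bounded_funrposneg cF FM FN.
have [D _ HD] := integral_abel_decay gd.
have intg f : box_bounded M N f ->
    lam.-integrable setT (EFin \o (fun y => f y * green x y `^ beta)) /\
    (\int[lam]_y (f y * green x y `^ beta))%R = k * fine (riesz_pot g f x).
  move=> fbox; have [mf fM _] := fbox.
  have f0 y : 0 <= f y by have /andP[] := fM y.
  have ff := riesz_pot_fin_num x N0 fbox HD.
  split; last by rewrite /Rintegral Hk// fineM.
  apply/integrableP; split.
    by apply/measurable_EFinP; apply: measurable_funM => //; exact: measurable_green_pow.
  under eq_integral do rewrite /= ger0_norm ?mulr_ge0 ?powR_ge0//.
  rewrite Hk//; apply: lte_mul_pinfty; rewrite ?lee_fin//.
  by rewrite -ge0_fin_numE// riesz_pot_ge0.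
have [ip Ep] := intg _ bp; have [iq Eq] := intg _ bn.
transitivity ((\int[lam]_y (F^\+ y * green x y `^ beta))%R -
    (\int[lam]_y (F^\- y * green x y `^ beta))%R); last by rewrite Ep Eq mulrBr.
rewrite -RintegralB//.
apply: eq_Rintegral => y _ /=; rewrite -mulrBl; congr (_ * _).
by rewrite -{1}(funrposBneg F).
Qed.

Lemma linear_green_op : linear_on_CK (@green_op R d beta).
Proof.
move=> a F G CF CG x; rewrite /green_op.
have iF := integrable_green_pow x CF; have iG := integrable_green_pow x CG.
have iaF : lam.-integrable setT (EFin \o (fun y => a * (F y * green x y `^ beta))).
  by have := integrableZl measurableT a iF; apply: eq_integrable.
rewrite -RintegralZl// -RintegralD//.
by apply: eq_Rintegral => y _; rewrite mulrDl mulrA.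
Qed.

Lemma positive_green_op : positive_on_CK (@green_op R d beta).
Proof.
move=> F CF F0 x; apply: Rintegral_ge0 => y _.
by rewrite mulr_ge0 ?powR_ge0.
Qed.

Lemma bounded_green_op : bounded_on_CK (@green_op R d beta).
Proof.
move=> K cK; have [N [_ HN]] := compact_bounded cK.
have [D D0 HD] := integral_abel_decay gd.
have [k k0 Hk] := green_riesz_pot.
pose N' := Num.max (N + 1) 0.
have N0 : 0 <= N' by rewrite le_max lexx orbT.
exists (k * ((1 + (2 * pi) `^ (- (d%:R / 2)) * (2 * N') ^+ d) * D)).
move=> F c CF FK Fc x.
have [cF _] := CF; have mF := continuous_measurable_rV cF.
have fbox : box_bounded c N' (fun y => `|F y|).
  split.
  - exact: measurableT_comp.
  - by move=> y; rewrite normr_ge0 Fc.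
  - move=> y; rewrite normr_eq0 => Fy; rewrite le_max; apply/orP; left.
    by apply: (HN (N + 1)); [rewrite ltrDl|exact: FK].
have [mf fM _] := fbox.
apply: le_trans (le_normr_Rintegral measurableT (integrable_green_pow x CF)) _.
under eq_Rintegral do rewrite normrM (ger0_norm (powR_ge0 _ _)).
rewrite /Rintegral Hk// fineM//; last exact: (riesz_pot_fin_num x N0 fbox HD).
rewrite -mulrA; apply: ler_wpM2l => //.
rewrite -lee_fin fineK; last exact: (riesz_pot_fin_num x N0 fbox HD).
apply: le_trans (riesz_pot_le x mf fM (integral_box_le N0 fbox) HD) _.
by rewrite lee_fin le_eqVlt; apply/orP; left; apply/eqP; ring.
Qed.

Lemma continuous_green_op F : compactly_supported_continuous F ->
  continuous (green_op beta F : 'rV[R]_d -> R).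
Proof.
move=> CF x; apply: cvg_sequence_continuous => X cX.
have [k k0 Hk] := green_op_riesz_pot.
have [M [N [N0 FM FN]]] := compactly_supported_bounded CF; have [cF _] := CF.
have [bp bn] := box_bounded_funrposneg cF FM FN.
have [D _ HD] := integral_abel_decay gd.
rewrite (Hk _ CF); under eq_fun do rewrite (Hk _ CF).
apply: cvgM; first exact: cvg_cst.
have cf f : box_bounded M N f -> fine (riesz_pot g f (X n)) @[n --> \oo] --> fine
  (riesz_pot g f x).
  move=> fbox; apply: fine_cvg; rewrite fineK; last exact: (riesz_pot_fin_num x N0
    fbox HD).
  exact: (cvg_riesz_pot N0 fbox HD cX).
by apply: cvgB; exact: cf.
Qed.

(** Where F >= 0, and so off the compact support, the potential is at most 1. A
    larger value is thus dominated by the maximum over the support, which is then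
    a global maximum and lies where F < 0. *)
Lemma green_op_maximum F : compactly_supported_continuous F ->
  (forall x, 0 <= F x -> green_op beta F x <= 1) -> forall x, green_op beta F x <= 1.
Proof.
move=> CF H x1; rewrite leNgt; apply/negP => V1.
have [k k0 Hk] := green_op_riesz_pot.
have [D _ HD] := integral_abel_decay gd.
have neg x : 1 < green_op beta F x -> F x < 0.
  by move=> V; rewrite ltNge; apply/negP => /H; rewrite leNgt V.
have [_ cK] := CF; set K := closure _ in cK.
have FK y : F y != 0 -> K y by move=> Fy; exact: subset_closure.
have Kx1 : K x1 by apply: FK; rewrite lt_eqF ?neg.
have [|x0 _ Hx0] := compact_EVT_max (ex_intro _ _ Kx1) cK (f := green_op beta F).
  by apply: continuous_subspaceT; exact: continuous_green_op.
have Vx0 : 1 < green_op beta F x0 by apply: lt_le_trans V1 _; apply: Hx0; rewrite inE.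
have Hmax x : green_op beta F x <= green_op beta F x0.
  have [Kx|nKx] := pselect (K x); first by apply: Hx0; rewrite inE.
  apply: le_trans (ltW Vx0); apply: H.
  by have [->//|/FK] := eqVneq (F x) 0.
have kp : 0 < k.
  rewrite lt_neqAle k0 andbT; apply/negP => /eqP kz.
  by move: Vx0; rewrite (Hk _ CF) -kz mul0r ltNge ler01.
have : 0 <= F x0.
  apply: (no_negative_maximum g01 HD CF) => x.
  by have := Hmax x; rewrite !(Hk _ CF) ler_pM2l.
by rewrite leNgt neg.
Qed.

End green.

Theorem theorem2p6 (R : realType) (d : nat) (beta : R) :
  (3 <= d)%N -> 1 <= beta < d%:R / (d%:R - 2) ->
  complete_maximum_principle (@green_op R d beta).
Proof.
move=> d3 /andP[b1 bd]; split.
- exact: linear_green_op.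
- exact: positive_green_op.
- exact: bounded_green_op.
- by move=> F CF HF x; exact: green_op_maximum.
Qed.
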